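(* Let $p^{(1)},p^{(2)}:E\to[0,1]$ and $V^{(1)},V^{(2)}:E\to\mathbb{R}$ be measurable functions. Consider the following system, required to hold for all $x\in E$: \begin{align*} \text{(a)}\quad & V^{(1)}(x)=\max\{(1-p^{(2)}(x))\alpha\Pi V^{(1)}(x)+p^{(2)}(x)g_1(x),\ (1-p^{(2)}(x))f_1(x)+p^{(2)}(x)h_1(x)\},\\ \text{(b)}\quad & V^{(2)}(x)=\max\{(1-p^{(1)}(x))\alpha\Pi V^{(2)}(x)+p^{(1)}(x)g_2(x),\ (1-p^{(1)}(x))f_2(x)+p^{(1)}(x)h_2(x)\},\\ \text{(c)}\quad & p^{(1)}(x)>0\Rightarrow (1-p^{(2)}(x))\alpha\Pi V^{(1)}(x)+p^{(2)}(x)g_1(x)\le (1-p^{(2)}(x))f_1(x)+p^{(2)}(x)h_1(x),\\ \text{(d)}\quad & p^{(1)}(x)<1\Rightarrow (1-p^{(2)}(x))\alpha\Pi V^{(1)}(x)+p^{(2)}(x)g_1(x)\ge (1-p^{(2)}(x))f_1(x)+p^{(2)}(x)h_1(x),\\ \text{(e)}\quad & p^{(2)}(x)>0\Rightarrow (1-p^{(1)}(x))\alpha\Pi V^{(2)}(x)+p^{(1)}(x)g_2(x)\le (1-p^{(1)}(x))f_2(x)+p^{(1)}(x)h_2(x),\\ \text{(f)}\quad & p^{(2)}(x)<1\Rightarrow (1-p^{(1)}(x))\alpha\Pi V^{(2)}(x)+p^{(1)}(x)g_2(x)\ge (1-p^{(1)}(x))f_2(x)+p^{(1)}(x)h_2(x).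 \end{align*} (A) Suppose $(p^{(1)},p^{(2)})$ is a global Markovian randomized equilibrium with values $(V^{(1)},V^{(2)})$. Then these functions satisfy the system (a)--(f). (B) Suppose $p^{(1)},p^{(2)},V^{(1)},V^{(2)}$ satisfy the system (a)--(f) and, for $i=1,2$, $V^{(i)}(\tilde X_1)\in L^1$ and $\mathbb{E}_x[\sup_{n\in\mathbb{N}_0}V^{(i)}(\tilde X_n)]<\infty$ for all $x\in E$. Then $(p^{(1)},p^{(2)})$ is a global Markovian randomized equilibrium with values $(V^{(1)},V^{(2)})$.
   Context: Setting. $X=(X_n)_{n\in\mathbb{N}_0}$ is a homogeneous Markov process with (measurable) state space $E$ and Markov kernel $\Pi$; under $\mathbb{P}_x$ (expectation $\mathbb{E}_x$) it starts at $X_0=x\in E$. Write $\Pi u(x)=\int_E u(y)\,\Pi(x,dy)$. The discount factor $\alpha\in(0,1)$ is constant and $f_i,g_i,h_i:E\to\mathbb{R}$, $i=1,2$, are measurable. The probability space supports two sequences $(\xi^{(i)}_n)_{n\in\mathbb{N}_0}$, $i=1,2$, of iid uniform $(0,1)$ random variables, independent of $X$ and of each other. Killed process. $\tilde X$ is the process $X$ killed at each time step with probability $1-\alpha$ (independently of everything else): $\tilde X_n=X_n$ for $n\le T$ and $\tilde X_n=K$ for $n>T$, where $\mathbb{P}(T=k)=(1-\alpha)\alpha^k$, $k\in\mathbb{N}_0$, and $K$ is an absorbing cemetery state at which all functions take the value $0$. Standing integrability assumption. For $i=1,2$ and under every $\mathbb{P}_x$: $\sup_{n}|f_i(\tilde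 X_n)|,\ \sup_{n}|g_i(\tilde X_n)|,\ \sup_{n}|h_i(\tilde X_n)|\in L^1$. Stopping times. $\mathcal{T}_i$ is the set of ($\mathbb{N}_0\cup\{\infty\}$-valued) stopping times with respect to the filtration $\sigma(X_0,\dots,X_n,\xi^{(i)}_0,\dots,\xi^{(i)}_n)$, $n\in\mathbb{N}_0$. For measurable $p^{(i)}:E\to[0,1]$, the Markovian randomized stopping time of player $i$ is $\tau^{p^{(i)}}=\inf\{n\in\mathbb{N}_0:\ p^{(i)}(X_n)\ge\xi^{(i)}_n\}$ ($\inf\emptyset=\infty$); it is identified with $p^{(i)}$. Rewards. For $\tau_1\in\mathcal{T}_1,\tau_2\in\mathcal{T}_2$ and $i,j\in\{1,2\}$, $j\neq i$, $$J_i(x;\tau_1,\tau_2)=\mathbb{E}_x\big[\alpha^{\tau_i}f_i(X_{\tau_i})\mathbb{I}_{\{\tau_i<\tau_j\}}+\alpha^{\tau_j}g_i(X_{\tau_j})\mathbb{I}_{\{\tau_j<\tau_i\}}+\alpha^{\tau_i}h_i(X_{\tau_i})\mathbb{I}_{\{\tau_i=\tau_j<\infty\}}\big].$$ Equilibrium. $(p^{(1)},p^{(2)})$ is a global Markovian randomized equilibrium if for all $x\in E$: $J_1(x;\tau^{p^{(1)}},\tau^{p^{(2)}})=\sup_{\tau_1\in\mathcal{T}_1}J_1(x;\tau_1,\tau^{p^{(2)}})$ and $J_2(x;\tau^{p^{(1)}},\tau^{p^{(2)}})=\sup_{\tau_2\in\mathcal{T}_2}J_2(x;\tau^{p^{(1)}},\tau_2)$.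 Its values are the functions $V^{(i)}(x)=J_i(x;\tau^{p^{(1)}},\tau^{p^{(2)}})$, $i=1,2$. Membership in $L^1$ is meant under every $\mathbb{P}_x$, $x\in E$. *)

(* Defs.v *)
From HB Require Import structures.
From mathcomp Require Import all_boot all_order all_algebra.
From mathcomp Require Import all_classical all_reals all_analysis.

Set Implicit Arguments.
Unset Strict Implicit.
Unset Printing Implicit Defensive.

Import Order.TTheory GRing.Theory Num.Theory.
Import numFieldNormedType.Exports.

Local Open Scope classical_set_scope.
Local Open Scope ring_scope.
Local Open Scope ereal_scope.

Definition sigma_process d d' (Omega : measurableType d) (S : measurableType d')
    (Y : nat -> Omega -> S) (D : set nat) : set (set Omega) :=
  <<s \bigcup_(k in D) preimage_set_system setT (Y k) measurable >>.

(* The values are prescribed on measurable sets only, and the starting point is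
   expressed through the law of [X 0] because [[set x]] need not be measurable.
   The last clause is P(X_(n+1) \in B | X_0, ..., X_n) = Pi(X_n, B). *)
Definition markov_process d d' (R : realType) (E : measurableType d)
    (Omega : measurableType d') (Pi : R.-pker E ~> E)
    (P : E -> probability Omega R) (X : nat -> {mfun Omega >-> E}) : Prop :=
  forall x : E,
    (forall B : set E, measurable B -> distribution (P x) (X 0%N) B = \d_x B) /\
    (forall (n : nat) (A : set Omega) (B : set E),
      sigma_process X [set k | (k <= n)%N] A -> measurable B ->
      P x (A `&` X n.+1 @^-1` B) = \int[P x]_(w in A) Pi (X n w) B).

Definition iid_uniform d (R : realType) (Omega : measurableType d)
    (P : probability Omega R) (xi : nat -> {mfun Omega >-> R}) : Prop :=
  (forall (n : nat) (B : set R), measurable B ->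
    distribution P (xi n) B = uniform_prob (@ltr01 R) B) /\
  (forall (s : seq nat) (B : nat -> set R), uniq s ->
    (forall n, measurable (B n)) ->
    P (\bigcap_(n in [set` s]) (xi n @^-1` B n)) =
    \prod_(n <- s) P (xi n @^-1` B n)).

(* For sigma-algebras the product rule for subfamilies is included, by taking
   the remaining sets equal to the whole space. *)
Definition independent4 d (R : realType) (Omega : measurableType d)
    (P : probability Omega R) (G1 G2 G3 G4 : set (set Omega)) : Prop :=
  forall A1 A2 A3 A4 : set Omega, G1 A1 -> G2 A2 -> G3 A3 -> G4 A4 ->
    P (A1 `&` A2 `&` A3 `&` A4) = P A1 * P A2 * P A3 * P A4.

Definition killing_time d (R : realType) (Omega : measurableType d)
    (P : probability Omega R) (alpha : R) (T : {mfun Omega >-> nat}) : Prop :=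
  forall k : nat, P (T @^-1` [set k]) = ((1 - alpha) * alpha ^+ k)%:E.

(* [None] is the cemetery state. *)
Definition killed (Omega E : Type) (T : Omega -> nat) (X : nat -> Omega -> E)
    (n : nat) (w : Omega) : option E :=
  if (n <= T w)%N then Some (X n w) else None.

Definition ext0 (R : realType) (E : Type) (u : E -> R) (e : option E) : R :=
  if e is Some x then u x else 0%R.

Definition L1 d (R : realType) (Omega : measurableType d)
    (P : probability Omega R) (Z : Omega -> \bar R) : Prop :=
  P.-integrable setT Z.

Definition sup_killed (R : realType) (Omega E : Type) (T : Omega -> nat)
    (X : nat -> Omega -> E) (u : E -> R) (w : Omega) : \bar R :=
  ereal_sup [set (ext0 u (killed T X n w))%:E | n in [set: nat]].

Definition sup_abs_killed (R : realType) (Omega E : Type) (T : Omega -> nat)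
    (X : nat -> Omega -> E) (u : E -> R) : Omega -> \bar R :=
  sup_killed T X (fun x => `|u x|%R).

(* Times take values in [option nat], [None] being infinity. *)
Definition time_lt (s t : option nat) : bool :=
  match s, t with
  | Some m, Some n => (m < n)%N
  | Some _, None => true
  | None, _ => false
  end.

Definition filtration d d' (R : realType) (E : measurableType d)
    (Omega : measurableType d') (X : nat -> {mfun Omega >-> E})
    (xi : nat -> {mfun Omega >-> R}) (n : nat) : set (set Omega) :=
  <<s sigma_process X [set k | (k <= n)%N] `|`
      sigma_process xi [set k | (k <= n)%N] >>.

Definition stopping_times d d' (R : realType) (E : measurableType d)
    (Omega : measurableType d') (X : nat -> {mfun Omega >-> E})
    (xi : nat -> {mfun Omega >-> R}) : set (Omega -> option nat) :=
  [set tau | forall n : nat,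
    filtration X xi n [set w | exists2 k, (k <= n)%N & tau w = Some k]].

Definition markovian_time (R : realType) (Omega E : Type)
    (X : nat -> Omega -> E) (xi : nat -> Omega -> R) (p : E -> R)
    (w : Omega) : option nat :=
  match pselect (exists n, (xi n w <= p (X n w))%R) with
  | left ex => Some (ex_minn ex)
  | right _ => None
  end.

(* The value 0 at an infinite time is immaterial: it is always multiplied by a
   vanishing indicator in [reward]. *)
Definition discounted (R : realType) (Omega E : Type) (alpha : R)
    (X : nat -> Omega -> E) (u : E -> R) (t : option nat) (w : Omega) : R :=
  if t is Some n then (alpha ^+ n * u (X n w))%R else 0%R.

(* [ti] is the time of the player who receives the reward. *)
Definition reward d (R : realType) (Omega : measurableType d) (E : Type)
    (P : probability Omega R) (alpha : R) (X : nat -> Omega -> E)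
    (f g h : E -> R) (ti tj : Omega -> option nat) : \bar R :=
  'E_P[fun w => (discounted alpha X f (ti w) w * (time_lt (ti w) (tj w))%:R
               + discounted alpha X g (tj w) w * (time_lt (tj w) (ti w))%:R
               + discounted alpha X h (ti w) w
                   * ((ti w == tj w) && time_lt (ti w) None)%:R)%R].

Definition global_equilibrium d d' (R : realType) (E : measurableType d)
    (Omega : measurableType d') (P : E -> probability Omega R) (alpha : R)
    (X : nat -> {mfun Omega >-> E}) (xi1 xi2 : nat -> {mfun Omega >-> R})
    (f1 g1 h1 f2 g2 h2 p1 p2 : E -> R) : Prop :=
  let tau1 := markovian_time X xi1 p1 in
  let tau2 := markovian_time X xi2 p2 in
  forall x : E,
    reward (P x) alpha X f1 g1 h1 tau1 tau2 =
      ereal_sup [set reward (P x) alpha X f1 g1 h1 t tau2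
                | t in stopping_times X xi1] /\
    reward (P x) alpha X f2 g2 h2 tau2 tau1 =
      ereal_sup [set reward (P x) alpha X f2 g2 h2 t tau1
                | t in stopping_times X xi2].

Definition equilibrium_values d d' (R : realType) (E : measurableType d)
    (Omega : measurableType d') (P : E -> probability Omega R) (alpha : R)
    (X : nat -> {mfun Omega >-> E}) (xi1 xi2 : nat -> {mfun Omega >-> R})
    (f1 g1 h1 f2 g2 h2 p1 p2 V1 V2 : E -> R) : Prop :=
  let tau1 := markovian_time X xi1 p1 in
  let tau2 := markovian_time X xi2 p2 in
  forall x : E,
    (V1 x)%:E = reward (P x) alpha X f1 g1 h1 tau1 tau2 /\
    (V2 x)%:E = reward (P x) alpha X f2 g2 h2 tau2 tau1.

Definition kernel_op d (R : realType) (E : measurableType d)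
    (Pi : R.-pker E ~> E) (u : E -> R) (x : E) : \bar R :=
  \int[Pi x]_y (u y)%:E.

(* [q] is the stopping probability of the opponent. *)
Definition continuation d (R : realType) (E : measurableType d)
    (Pi : R.-pker E ~> E) (alpha : R) (q V g : E -> R) (x : E) : \bar R :=
  (1 - q x)%:E * (alpha%:E * kernel_op Pi V x) + (q x * g x)%:E.

Definition stopping (R : realType) (E : Type) (q f h : E -> R) (x : E) :
    \bar R :=
  ((1 - q x) * f x + q x * h x)%:E.

Definition equilibrium_system d (R : realType) (E : measurableType d)
    (Pi : R.-pker E ~> E) (alpha : R)
    (f1 g1 h1 f2 g2 h2 p1 p2 V1 V2 : E -> R) : Prop :=
  forall x : E,
    (V1 x)%:E = maxe (continuation Pi alpha p2 V1 g1 x) (stopping p2 f1 h1 x) /\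
    (V2 x)%:E = maxe (continuation Pi alpha p1 V2 g2 x) (stopping p1 f2 h2 x) /\
    ((0 < p1 x)%R ->
      continuation Pi alpha p2 V1 g1 x <= stopping p2 f1 h1 x) /\
    ((p1 x < 1)%R ->
      continuation Pi alpha p2 V1 g1 x >= stopping p2 f1 h1 x) /\
    ((0 < p2 x)%R ->
      continuation Pi alpha p1 V2 g2 x <= stopping p1 f2 h2 x) /\
    ((p2 x < 1)%R ->
      continuation Pi alpha p1 V2 g2 x >= stopping p1 f2 h2 x).

(* Main.v *)
Require Import Defs.
From HB Require Import structures.
From mathcomp Require Import all_boot all_order all_algebra.
From mathcomp Require Import all_classical all_reals all_analysis.
From mathcomp Require Import measurable_realfun.
From mathcomp Require Import ring lra.

(** Why the theorem is true. Look at one player, with rewards [f], [g], [h] and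
    stopping probability [p], against an opponent who stops with probability
    [q]. In state [y] stopping is worth [S = (1 - q) f + q h], and continuing
    is worth [C = (1 - q) alpha Pi V + q g] if a continued play is worth [V]
    one period later. The system says that [V = max (C, S)] and that [p] only
    mixes actions attaining this maximum. The two players enter symmetrically
    ([randomized_model_swap]), so one player is treated at a time.

    Both directions rest on an identity for one period ([one_step]). On the
    event that nobody has stopped before time [n], the own decision at [n] is
    known before the opponent's uniform draw at [n], and that draw is known
    before [X (n + 1)]. Integrating out the draw and then the transition
    replaces the reward due at time [n], plus a continuation payoff [u] at time
    [n + 1], by [S] where the own time stops, and by [C] with [u] for [V] where
    it goes on. The three probabilistic inputs are the Markov property in
    presence of the randomization devices ([integral_transition]), the
    independence of a uniform draw from everything known before it
    ([integral_stop], [integral_continue]), and the fact that discounting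
    amounts to killing at an independent geometric time ([pay_killed]).

    Sufficiency is a verification argument ([verification_le],
    [verification_eq]). As [C <= V] and [S <= V], the rewards of the first [n]
    periods plus the remaining value [alpha ^ n V(X n)] on the event that play
    goes on have expectation at most [V x], with equality when both players use
    [p] and [q]. The remainder is an expectation over [T >= n] of a function
    bounded by the supremum of [|V|] along the killed process, and it tends to
    [0] since that supremum is integrable: from above by assumption, from below
    because [V >= S >= - |f| - |h|].

    Necessity is the one-shot deviation principle ([necessary_conditions]).
    Playing a probability [r] in the first period and [p] from then on earns
    [r S + (1 - r) C] ([deviation_value]). The choices [r = 0] and [r = 1] give
    [C <= V] and [S <= V] by optimality, and [r = p] gives
    [V = p S + (1 - p) C]; the system is the combination of the three. Since
    [P] is not a kernel, that a play renewed at time [1] is worth [V (X 1)]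
    comes from value iteration, which only involves [Pi] and converges to the
    value of a Markovian play ([play_valueE]).

    Rewards are signed, and [V] may fail to be integrable under [Pi y] at a
    state [y] where the opponent stops for sure. All integrals are therefore
    taken of functions with values in [0, +oo], the positive and the negative
    parts of the rewards being carried along separately and subtracted at the
    end ([reward_split]). *)

Import Order.TTheory GRing.Theory Num.Theory.
Import numFieldNormedType.Exports.

Set Implicit Arguments.
Unset Strict Implicit.
Unset Printing Implicit Defensive.

Local Open Scope classical_set_scope.
Local Open Scope ring_scope.
Local Open Scope ereal_scope.

(** * Mixtures of measures *)

Section density.
Context d (T : measurableType d) (R : realType)
  (m : {measure set T -> \bar R}) (f : T -> \bar R).
Hypotheses (mf : measurable_fun setT f) (f0 : forall w, 0 <= f w).

(** The hypotheses are arguments so that the measure structure can be inferred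
    from the term itself. *)
Definition density (_ : measurable_fun setT f) (_ : forall w, 0 <= f w)
  (A : set T) : \bar R := \int[m]_(w in A) f w.

Let density0 : density mf f0 set0 = 0.
Proof. exact: integral_set0. Qed.

Let density_ge0 A : 0 <= density mf f0 A.
Proof. exact: integral_ge0. Qed.

Let density_sigma_additive : semi_sigma_additive (density mf f0).
Proof. exact: semi_sigma_additive_nng_induced. Qed.

HB.instance Definition _ := isMeasure.Build _ _ _ (density mf f0)
  density0 density_ge0 density_sigma_additive.

End density.

Section mixture.
Context d1 d2 (T : measurableType d1) (S : measurableType d2) (R : realType).
Variables (m : {measure set T -> \bar R}) (D : set T)
  (k : T -> {measure set S -> \bar R}).
Hypotheses (mD : measurable D)
  (mk : forall B, measurable B -> measurable_fun setT (k ^~ B)).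

Definition mixture (_ : measurable D)
  (_ : forall B, measurable B -> measurable_fun setT (k ^~ B))
  (B : set S) : \bar R := \int[m]_(w in D) k w B.

Local Notation nu := (mixture mD mk).

Let mixture0 : nu set0 = 0.
Proof. by apply: integral0_eq => w _; rewrite measure0. Qed.

Let mixture_ge0 B : 0 <= nu B.
Proof. by apply: integral_ge0. Qed.

Let mixture_sigma_additive : semi_sigma_additive nu.
Proof.
move=> F mF tF mUF.
have -> : nu (\bigcup_n F n) = \sum_(i <oo) nu (F i).
  rewrite /mixture -integral_nneseries//; last first.
    by move=> n; apply: measurable_funTS; exact: mk.
  by apply: eq_integral => w _; rewrite measure_semi_bigcup.
by apply: is_cvg_ereal_nneg_natsum_cond.
Qed.

HB.instance Definition _ := isMeasure.Build _ _ _ nu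
  mixture0 mixture_ge0 mixture_sigma_additive.

Import HBNNSimple.

Let integral_mixture_nnsfun (f : {nnsfun S >-> R}) :
  \int[nu]_z (f z)%:E = \int[m]_(w in D) (\int[k w]_z (f z)%:E).
Proof.
under [in LHS]eq_integral do rewrite fimfunE -fsumEFin//.
rewrite ge0_integral_fsum//; last 2 first.
  - by move=> r; exact/measurable_EFinP/measurableT_comp.
  - by move=> r z _; rewrite EFinM nnfun_muleindic_ge0.
under [in RHS]eq_integral.
  move=> y _.
  under eq_integral.
    by move=> z _; rewrite fimfunE -fsumEFin//; over.
  rewrite /= ge0_integral_fsum//; last 2 first.
    - by move=> r; exact/measurable_EFinP/measurableT_comp.
    - by move=> r z _; rewrite EFinM nnfun_muleindic_ge0.
  under eq_fsbigr.
    move=> r _.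
    rewrite (integralZl_indic _ (fun r => f @^-1` [set r]))//; last first.
      by move=> r0; rewrite preimage_nnfun0.
    rewrite integral_indic// setIT.
    over.
  over.
rewrite /= ge0_integral_fsum//; last 2 first.
  - move=> r; apply: measurable_funeM; apply: measurable_funTS; exact: mk.
  - move=> n y _.
    have := mulemu_ge0 (fun n => f @^-1` [set n]).
    by apply; exact: preimage_nnfun0.
apply: eq_fsbigr => r _.
rewrite (integralZl_indic _ (fun r => f @^-1` [set r]))//; last first.
  exact: preimage_nnfun0.
rewrite integral_indic// setIT.
have [r0|r0] := leP 0%R r.
  by rewrite ge0_integralZl//; apply: measurable_funTS; exact: mk.
rewrite preimage_nnfun0// measure0 mule0.
by rewrite integral0_eq// => y _; rewrite measure0 mule0.
Qed.

(** Both sides are linear and continuous along increasing sequences, so the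
    defining case of indicator functions extends to simple functions and then to
    all nonnegative measurable ones. *)
Lemma integral_mixture (f : S -> \bar R) :
  (forall z, 0 <= f z) -> measurable_fun setT f ->
  \int[nu]_z f z = \int[m]_(w in D) (\int[k w]_z f z).
Proof.
move=> f0 mf; pose f_ := nnsfun_approx measurableT mf.
have approx (mu : {measure set S -> \bar R}) :
    \int[mu]_z f z = limn (fun n => \int[mu]_z (f_ n z)%:E).
  rewrite -monotone_convergence//; last 3 first.
  - by move=> n; exact/measurable_EFinP.
  - by move=> n z _; rewrite lee_fin.
  - by move=> z _ a b ab; rewrite lee_fin; exact/lefP/nd_nnsfun_approx.
  apply/eq_integral => z _; apply/esym/cvg_lim => //=.
  exact: cvg_nnsfun_approx.
rewrite approx.
under eq_fun do rewrite integral_mixture_nnsfun.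
rewrite -monotone_convergence//; last 3 first.
- move=> n; apply: measurable_funTS.
  apply: measurable_fun_integral_kernel => //.
  + by move=> z; rewrite lee_fin.
  + exact/measurable_EFinP.
- by move=> n y _; apply: integral_ge0 => // z _; rewrite lee_fin.
- move=> y _ a b ab; apply: ge0_le_integral => //.
  + by move=> z _; rewrite lee_fin.
  + exact/measurable_EFinP.
  + exact/measurable_EFinP.
  + by move=> z _; rewrite lee_fin; exact/lefP/nd_nnsfun_approx.
by apply: eq_integral => w _; rewrite approx.
Qed.

End mixture.

(** Identities between integrals of functions only need to be checked on sets:
    image measures, transitions and thinnings are all mixtures of suitable
    kernels, and this lemma transfers each of them from sets to functions. *)
Lemma eq_integral_mixture d1 d2 d3 (T1 : measurableType d1)
  (T2 : measurableType d2) (S : measurableType d3) (R : realType)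
  (m1 : {measure set T1 -> \bar R}) (m2 : {measure set T2 -> \bar R})
  (D1 : set T1) (D2 : set T2)
  (k1 : T1 -> {measure set S -> \bar R}) (k2 : T2 -> {measure set S -> \bar R})
  (f : S -> \bar R) :
  measurable D1 -> measurable D2 ->
  (forall B, measurable B -> measurable_fun setT (k1 ^~ B)) ->
  (forall B, measurable B -> measurable_fun setT (k2 ^~ B)) ->
  (forall B, measurable B ->
    \int[m1]_(w in D1) k1 w B = \int[m2]_(w in D2) k2 w B) ->
  (forall z, 0 <= f z) -> measurable_fun setT f ->
  \int[m1]_(w in D1) \int[k1 w]_z f z = \int[m2]_(w in D2) \int[k2 w]_z f z.
Proof.
move=> mD1 mD2 mk1 mk2 E f0 mf.
rewrite -(integral_mixture _ mD1 mk1)//.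
rewrite -(integral_mixture _ mD2 mk2)//.
by apply: eq_measure_integral => B mB _; exact: E.
Qed.

(** * Integrals along random elements *)

Section image_integrals.
Context d d' (Omega : measurableType d) (S : measurableType d') (R : realType)
  (mu : {measure set Omega -> \bar R}).

Lemma integral_diracT (z : S) (f : S -> \bar R) :
  measurable_fun setT f -> \int[\d_z]_y f y = f z.
Proof. by move=> mf; rewrite integral_dirac// diracT mul1e. Qed.

Lemma measurable_dirac_comp (Y : Omega -> S) (B : set S) :
  measurable_fun setT Y -> measurable B ->
  measurable_fun setT (fun w => \d_(Y w) B : \bar R).
Proof.
move=> mY mB; apply: (measurableT_comp (f := fun z => \d_z B : \bar R)) => //.
exact: measurable_fun_dirac.
Qed.

Lemma integral_dirac_comp (A : set Omega) (Y : Omega -> S) (B : set S) :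
  measurable A -> measurable_fun setT Y -> measurable B ->
  \int[mu]_(w in A) (\d_(Y w) B : \bar R) = mu (A `&` Y @^-1` B).
Proof.
move=> mA mY mB.
rewrite (_ : (fun w => _) = fun w => (\1_(Y @^-1` B) w)%:E)//.
rewrite integral_indic// 1?setIC//.
by rewrite -[X in measurable X]setTI; exact: mY.
Qed.

(** The instances of interest have [A' = A `&` C] with [C] independent of [A]
    and [Y], and [c] the probability of [C]. *)
Lemma integral_comp_scale (A A' : set Omega) (Y : Omega -> S) (c : R)
    (v : S -> \bar R) :
  measurable A -> measurable A' -> measurable_fun setT Y -> (0 <= c)%R ->
  (forall B, measurable B ->
    mu (A' `&` Y @^-1` B) = c%:E * mu (A `&` Y @^-1` B)) ->
  (forall z, 0 <= v z) -> measurable_fun setT v ->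
  \int[mu]_(w in A') v (Y w) = c%:E * \int[mu]_(w in A) v (Y w).
Proof.
move=> mA mA' mY c0 E v0 mv.
pose cn := NngNum c0.
have mk B : measurable B -> measurable_fun setT (fun w => \d_(Y w) B : \bar R).
  exact: measurable_dirac_comp.
have mvY : measurable_fun setT (v \o Y) by exact: measurableT_comp.
transitivity (\int[mu]_(w in A') \int[\d_(Y w)]_y v y).
  by apply: eq_integral => w _; rewrite integral_diracT.
transitivity (\int[mscale cn mu]_(w in A) \int[\d_(Y w)]_y v y).
  apply: eq_integral_mixture => // B mB.
  rewrite ge0_integral_mscale//; last by apply: measurable_funTS; exact: mk.
  by rewrite !integral_dirac_comp// E.
rewrite [LHS](eq_integral (v \o Y)); last first.
  by move=> w _; rewrite integral_diracT.
rewrite ge0_integral_mscale//; first exact: measurable_funTS.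
by move=> w _; exact: v0.
Qed.

Lemma integral_comp_kernel (A : set Omega) (Y Z : Omega -> S)
    (Pi : R.-pker S ~> S) (v : S -> \bar R) :
  measurable A -> measurable_fun setT Y -> measurable_fun setT Z ->
  (forall B, measurable B ->
    mu (A `&` Y @^-1` B) = \int[mu]_(w in A) Pi (Z w) B) ->
  (forall z, 0 <= v z) -> measurable_fun setT v ->
  \int[mu]_(w in A) v (Y w) = \int[mu]_(w in A) \int[Pi (Z w)]_y v y.
Proof.
move=> mA mY mZ E v0 mv.
transitivity (\int[mu]_(w in A) \int[\d_(Y w)]_y v y).
  by apply: eq_integral => w _; rewrite integral_diracT.
apply: eq_integral_mixture => //.
- by move=> B mB; exact: measurable_dirac_comp.
- move=> B mB; apply: (measurableT_comp (f := fun z => Pi z B)) => //.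
  exact: measurable_kernel.
- by move=> B mB; rewrite integral_dirac_comp// E.
Qed.

End image_integrals.

Section independent_coordinate.
Context d d' d'' (Omega : measurableType d) (S : measurableType d')
  (S' : measurableType d'') (R : realType)
  (mu : {finite_measure set Omega -> \bar R}) (nu : probability S' R).

(** On the event [A], the pair [(Y, U)] has the law of [Y] on [A] times [nu]:
    the two measures agree on rectangles, hence everywhere. The product is
    written as a mixture over [A] of the image measures of [nu] under
    [u |-> (Y w, u)]. *)
Lemma integral_indep_coordinate (A : set Omega) (Y : Omega -> S)
    (U : Omega -> S') (F : S * S' -> \bar R) :
  measurable A -> measurable_fun setT Y -> measurable_fun setT U ->
  (forall B C, measurable B -> measurable C ->
    mu (A `&` Y @^-1` B `&` U @^-1` C) = mu (A `&` Y @^-1` B) * nu C) ->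
  (forall z, 0 <= F z) -> measurable_fun setT F ->
  \int[mu]_(w in A) F (Y w, U w) = \int[mu]_(w in A) \int[nu]_u F (Y w, u).
Proof.
move=> mA mY mU E F0 mF.
have mYU : measurable_fun setT (fun w => (Y w, U w)).
  exact: measurable_fun_pair.
have mpair (y : S) : measurable_fun setT (fun u : S' => (y, u)).
  exact: measurable_fun_pair.
have mk2 w (B : set (S * S')) : measurable B ->
    measurable_fun setT (fun u => \d_(Y w, u) B : \bar R).
  by move=> mB; apply: measurable_dirac_comp.
pose k2 w : {measure set (S * S') -> \bar R} :=
  mixture nu measurableT (mk2 w).
have intk2 w f : (forall z, 0 <= f z) -> measurable_fun setT f ->
    \int[k2 w]_z f z = \int[nu]_u f (Y w, u).
  move=> f0 mf; rewrite integral_mixture//.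
  by apply: eq_integral => u _; rewrite integral_diracT.
have mk1 (B : set (S * S')) : measurable B ->
    measurable_fun setT (fun w => \d_(Y w, U w) B : \bar R).
  by move=> mB; apply: measurable_dirac_comp.
have mk2' (B : set (S * S')) : measurable B ->
    measurable_fun setT (fun w => k2 w B).
  move=> mB; apply: (measurableT_comp
    (f := fun y => \int[nu]_u (\d_(y, u) B : \bar R))) => //.
  apply: (measurable_fun_fubini_tonelli_F (m2 := nu)
    (fun z => \d_z B : \bar R)) => //.
  exact: measurable_fun_dirac.
transitivity (\int[mu]_(w in A) \int[\d_(Y w, U w)]_z F z).
  by apply: eq_integral => w _; rewrite integral_diracT.
transitivity (\int[mu]_(w in A) \int[k2 w]_z F z); last first.
  by apply: eq_integral => w _; rewrite intk2.
apply: eq_integral_mixture => // B mB.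
pose m1 : {measure set (S * S') -> \bar R} := mixture mu mA mk1.
pose m2 : {measure set (S * S') -> \bar R} := mixture mu mA mk2'.
have m1X B1 B2 : measurable B1 -> measurable B2 ->
    m1 (B1 `*` B2) = mu (A `&` Y @^-1` B1 `&` U @^-1` B2).
  move=> mB1 mB2; rewrite /m1/= /mixture integral_dirac_comp//.
    by rewrite -setIA.
  exact: measurableX.
have m2X B1 B2 : measurable B1 -> measurable B2 ->
    m2 (B1 `*` B2) = mu (A `&` Y @^-1` B1) * nu B2.
  move=> mB1 mB2; rewrite /m2/= /mixture.
  transitivity (\int[mu]_(w in A) (nu B2 * \d_(Y w) B1)).
    apply: eq_integral => w _; rewrite /k2/= /mixture.
    transitivity (\int[nu]_u (\d_(Y w) B1 * \d_u B2 : \bar R)).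
      apply: eq_integral => u _.
      by rewrite [LHS]diracE !diracE classical_sets.in_setX -EFinM -natrM mulnb.
    rewrite ge0_integralZl//; last exact: measurable_fun_dirac.
    by rewrite (integral_dirac_comp _ (Y := id))//= setTI muleC.
  rewrite ge0_integralZl//.
    by rewrite integral_dirac_comp// muleC.
  by apply: measurable_funTS; apply: measurable_dirac_comp.
suff : m1 B = m2 B by [].
apply: (measure_unique [set A `*` B | A in measurable & B in measurable]
  (fun=> setT)) => //.
- by rewrite measurable_prod_measurableType.
- move=> _ _ [X1 mX1 [X2 mX2 <-]] [Y1 mY1 [Y2 mY2 <-]].
  exists (X1 `&` Y1); first exact: measurableI.
  by exists (X2 `&` Y2); [exact: measurableI|rewrite setXI].
- by move=> _; exists setT => //; exists setT => //; rewrite setXTT.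
- exact: bigcup_const.
- by move=> _ [B1 mB1 [B2 mB2 <-]]; rewrite m1X// m2X// E.
- move=> _; rewrite -setXTT m1X// ltey_eq fin_num_measure//.
  by rewrite !preimage_setT !setIT.
Qed.

End independent_coordinate.

Section uniform.
Context (R : realType).
Implicit Types r : R.
Local Notation unif := (uniform_prob (@ltr01 R)).

Lemma uniform_le r : (0 <= r <= 1)%R -> unif [set u | (u <= r)%R] = r%:E.
Proof.
move=> /andP[r0 r1]; rewrite /uniform_prob integral_uniform_pdf.
have -> : [set u | (u <= r)%R] `&` `[0%R, 1%R]%classic = `[0%R, r]%classic.
  apply/seteqP; split => u /=; rewrite !in_itv/=.
    by move=> [ur /andP[-> _]].
  by move=> /andP[-> ur]; rewrite ur (le_trans ur r1).
rewrite (eq_integral (cst 1)); last first.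
  move=> u; rewrite inE/= in_itv/= => /andP[u0 ur].
  by rewrite /uniform_pdf u0 (le_trans ur r1) subr0 invr1.
rewrite integral_cst//= mul1e lebesgue_measure_itv/= lte_fin.
by move: r0; rewrite le_eqVlt => /predU1P[<-|->]; rewrite ?ltxx ?oppr0 ?adde0.
Qed.

Lemma uniform_gt r : (0 <= r <= 1)%R ->
  unif [set u | (r < u)%R] = (1 - r)%:E.
Proof.
move=> r01; have -> : [set u | (r < u)%R] = ~` [set u | (u <= r)%R].
  by apply/seteqP; split => u /=; rewrite ltNge => /negP.
rewrite probability_setC.
  by rewrite EFinB; congr (_ - _); exact: uniform_le.
by rewrite -set_itvNyc; exact: measurable_itv.
Qed.

End uniform.

(** * Generated sigma-algebras and independence *)

Section sub_sigma_algebras.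
Context d (Omega : measurableType d) (R : realType).

Lemma g_sigma_algebraI (G : set (set Omega)) A B :
  <<s G >> A -> <<s G >> B -> <<s G >> (A `&` B).
Proof. exact: (@measurableI _ (g_sigma_algebraType G)). Qed.

Lemma g_sigma_algebraC (G : set (set Omega)) A : <<s G >> A -> <<s G >> (~` A).
Proof. exact: (@measurableC _ (g_sigma_algebraType G)). Qed.

Lemma g_sigma_algebraD (G : set (set Omega)) A B :
  <<s G >> A -> <<s G >> B -> <<s G >> (A `\` B).
Proof. exact: (@measurableD _ (g_sigma_algebraType G)). Qed.

Lemma g_sigma_algebraT (G : set (set Omega)) : <<s G >> setT.
Proof. exact: (@measurableT _ (g_sigma_algebraType G)). Qed.

(** Reading [a] and [b] as measurable functions on the space that carries the
    generated sigma-algebra makes the standard comparison lemma available. *)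
Lemma g_sigma_algebra_le (G : set (set Omega)) (a b : Omega -> R) :
  (forall B, measurable B -> <<s G >> (a @^-1` B)) ->
  (forall B, measurable B -> <<s G >> (b @^-1` B)) ->
  <<s G >> [set w | (a w <= b w)%R].
Proof.
move=> ma mb.
have mfa : measurable_fun setT (a : g_sigma_algebraType G -> R).
  by move=> _ B mB; rewrite setTI; exact: ma.
have mfb : measurable_fun setT (b : g_sigma_algebraType G -> R).
  by move=> _ B mB; rewrite setTI; exact: mb.
by have := measurable_fun_le measurableT mfa mfb; rewrite setTI.
Qed.

Lemma g_sigma_algebra_sub (G : set (set Omega)) :
  G `<=` measurable -> <<s G >> `<=` measurable.
Proof. exact: smallest_sub (@sigma_algebra_measurable _ Omega). Qed.

(** The intersections [A1 `&` A2 `&` A3] form a pi-system generating the join of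
    the three sigma-algebras. *)
Lemma measure_unique_rectangles (G1 G2 G3 : set (set Omega))
    (m1 m2 : {measure set Omega -> \bar R}) :
  G1 setT -> G2 setT -> G3 setT ->
  setI_closed G1 -> setI_closed G2 -> setI_closed G3 ->
  G1 `<=` measurable -> G2 `<=` measurable -> G3 `<=` measurable ->
  m1 setT < +oo ->
  (forall A1 A2 A3, G1 A1 -> G2 A2 -> G3 A3 ->
    m1 (A1 `&` A2 `&` A3) = m2 (A1 `&` A2 `&` A3)) ->
  forall A, <<s G1 `|` G2 `|` G3 >> A -> m1 A = m2 A.
Proof.
move=> T1 T2 T3 I1 I2 I3 s1 s2 s3 m1T E.
pose C := [set A | exists A1 A2 A3, [/\ G1 A1, G2 A2, G3 A3 &
  A = A1 `&` A2 `&` A3]].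
have sC : <<s G1 `|` G2 `|` G3 >> `<=` <<s C >>.
  apply: sub_sigma_algebra2 => A [[GA|GA]|GA].
  - by exists A, setT, setT; rewrite !setIT.
  - by exists setT, A, setT; rewrite setTI setIT.
  - by exists setT, setT, A; rewrite !setTI.
move=> A /sC.
apply: (g_sigma_algebra_measure_unique C _ (fun=> setT)) => //.
- move=> _ [A1 [A2 [A3 [GA1 GA2 GA3 ->]]]].
  by apply: measurableI; [apply: measurableI; [exact: s1|exact: s2]|exact: s3].
- by move=> _; exists setT, setT, setT; rewrite !setIT.
- exact: bigcup_const.
- move=> _ _ [A1 [A2 [A3 [GA1 GA2 GA3 ->]]]] [B1 [B2 [B3 [GB1 GB2 GB3 ->]]]].
  exists (A1 `&` B1), (A2 `&` B2), (A3 `&` B3).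
  by split; [exact: I1|exact: I2|exact: I3|rewrite setIACA (setIACA A1)].
- by move=> _ [A1 [A2 [A3 [GA1 GA2 GA3 ->]]]]; exact: E.
Qed.

Lemma indep_generated (mu : probability Omega R) (G1 G2 G3 : set (set Omega))
    (C : set Omega) :
  G1 setT -> G2 setT -> G3 setT ->
  setI_closed G1 -> setI_closed G2 -> setI_closed G3 ->
  G1 `<=` measurable -> G2 `<=` measurable -> G3 `<=` measurable ->
  measurable C ->
  (forall A1 A2 A3, G1 A1 -> G2 A2 -> G3 A3 ->
    mu (A1 `&` A2 `&` A3 `&` C) = mu (A1 `&` A2 `&` A3) * mu C) ->
  forall A, <<s G1 `|` G2 `|` G3 >> A -> mu (A `&` C) = mu A * mu C.
Proof.
move=> T1 T2 T3 I1 I2 I3 s1 s2 s3 mC E A GA.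
have c0 : (0 <= fine (mu C))%R by rewrite fine_ge0.
have muC : mu C = (NngNum c0)%:num%:E by rewrite fineK// fin_num_measure.
rewrite muleC muC.
apply: (@measure_unique_rectangles G1 G2 G3 (mrestr mu mC)
  (mscale (NngNum c0) mu)) => //.
- by rewrite /= /mrestr setTI ltey_eq fin_num_measure.
- by move=> A1 A2 A3 GA1 GA2 GA3; rewrite /= /mrestr /mscale -muC E// muleC.
Qed.

End sub_sigma_algebras.

Section sigma_process_theory.
Context d d' (Omega : measurableType d) (S : measurableType d')
  (Y : nat -> {mfun Omega >-> S}).
Implicit Types (D : set nat).

Lemma sigma_process_sub D D' : D `<=` D' ->
  sigma_process Y D `<=` sigma_process Y D'.
Proof. by move=> DD'; apply: sub_sigma_algebra2; exact: bigcup_subset. Qed.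

Lemma sigma_process_measurable D : sigma_process Y D `<=` measurable.
Proof.
apply: g_sigma_algebra_sub => _ [n Dn] [B mB <-].
by rewrite setTI -[X in measurable X]setTI; exact: (measurable_funPT (Y n)).
Qed.

Lemma sigma_process_preimage D n B : D n -> measurable B ->
  sigma_process Y D (Y n @^-1` B).
Proof.
move=> Dn mB; apply: sub_sigma_algebra; exists n => //.
by exists B; rewrite // setTI.
Qed.

Lemma sigma_processI D : setI_closed (sigma_process Y D).
Proof. by move=> A B; exact: g_sigma_algebraI. Qed.

End sigma_process_theory.

Section iid.
Context d (Omega : measurableType d) (R : realType) (mu : probability Omega R).

(** The product rule is only given for finitely many coordinates; the cylinders
    over the first [n] coordinates form a pi-system, which gives independence of
    coordinate [n] from everything the first [n] coordinates generate. *)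
Lemma iid_past_indep (xi : nat -> {mfun Omega >-> R}) (n : nat) (A : set Omega)
    (C : set R) :
  iid_uniform mu xi -> sigma_process xi [set k | (k < n)%N] A ->
  measurable C ->
  mu (A `&` xi n @^-1` C) = mu A * uniform_prob (@ltr01 R) C.
Proof.
move=> [law prod] GA mC.
have muC : mu (xi n @^-1` C) = uniform_prob (@ltr01 R) C by exact: law.
have mxB k B : measurable B -> measurable (xi k @^-1` B).
  move=> mB; rewrite -[X in measurable X]setTI.
  exact: (measurable_funPT (xi k)).
rewrite -muC; pose cyl (B : nat -> set R) :=
  \bigcap_(k in [set` iota 0 n]) (xi k @^-1` B k).
pose G := [set A | exists2 B : nat -> set R,
  (forall k, measurable (B k)) & A = cyl B].
have GT : G setT.
  by exists (fun=> setT) => //; apply/seteqP; split.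
have GI : setI_closed G.
  move=> _ _ [B mB ->] [B' mB' ->]; exists (fun k => B k `&` B' k).
    by move=> k; exact: measurableI.
  by rewrite /cyl -bigcapI; apply: eq_bigcapr => k _; rewrite preimage_setI.
have Gm : G `<=` measurable.
  by move=> _ [B mB ->]; apply: bigcap_measurableType => // k _; exact: mxB.
have Gcyl : sigma_process xi [set k | (k < n)%N] `<=` <<s G `|` G `|` G >>.
  apply: sub_sigma_algebra2 => _ [k /= kn] [B mB <-]; left; left.
  exists (fun i => if i == k then B else setT).
    by move=> i; case: ifP.
  apply/seteqP; split => w /=.
    by move=> [_ Bw] i _ /=; case: ifP => // /eqP ->.
  move=> /(_ k); rewrite /= eqxx mem_iota => Bw; split => //.
  exact: Bw.
apply: (@indep_generated _ _ _ mu G G G) => //; [exact: mxB| |exact: Gcyl].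
move=> A1 A2 A3 GA1 GA2 GA3.
have [B mB ->] := GI _ _ (GI _ _ GA1 GA2) GA3.
have cylE (B' : nat -> set R) : (forall k, measurable (B' k)) ->
    mu (cyl B') = \prod_(k <- iota 0 n) mu (xi k @^-1` B' k).
  by move=> mB'; apply: prod => //; exact: iota_uniq.
pose B' k := if k == n then C else B k.
have mB' k : measurable (B' k) by rewrite /B'; case: ifP.
have -> : cyl B `&` xi n @^-1` C =
    \bigcap_(k in [set` iota 0 n.+1]) (xi k @^-1` B' k).
  have memS k : (k \in iota 0 n.+1) = (k <= n)%N by rewrite mem_iota.
  apply/seteqP; split => w.
    move=> [Bw Cw] k; rewrite /mkset memS leq_eqVlt /B' /preimage /mkset.
    case: eqVneq => [->//|_ /= kn]; apply: Bw.
    by rewrite /= mem_iota.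
  move=> Bw; split; last first.
    by have := Bw n; rewrite /mkset memS /B' eqxx => /(_ (leqnn _)).
  move=> k; rewrite /mkset mem_iota add0n => /andP[_ kn].
  have := Bw k; rewrite /B' /mkset memS (ltnW kn) (ltn_eqF kn).
  exact.
rewrite prod//; last exact: iota_uniq.
rewrite cylE// -[in LHS]addn1 iotaD big_cat/= big_seq1 add0n /B' eqxx.
congr (_ * _); apply: eq_big_seq => k.
by rewrite mem_iota/= add0n => kn; rewrite (ltn_eqF kn).
Qed.

End iid.

(** * The information of the players *)

Section noise.
Context d d' (E : measurableType d) (Omega : measurableType d') (R : realType).
Variables (mu : probability Omega R) (X : nat -> {mfun Omega >-> E})
  (xi eta : nat -> {mfun Omega >-> R}) (T : {mfun Omega >-> nat}).
Hypothesis indep : independent4 mu (sigma_process X setT)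
  (sigma_process xi setT) (sigma_process eta setT)
  (preimage_set_system setT T measurable).

(** The times at which the process, the own randomization and the opponent's
    randomization have been observed are kept apart: a period is resolved in
    three steps (the opponent's draw, the own draw, the move of the process),
    and each step has a past of its own. *)
Definition info (a b c : set nat) : set (set Omega) :=
  <<s sigma_process X a `|` sigma_process xi b `|` sigma_process eta c >>.

Lemma info_widen a b c a' b' c' A : info a b c A ->
  a `<=` a' -> b `<=` b' -> c `<=` c' -> info a' b' c' A.
Proof.
move=> GA aa' bb' cc'; move: GA; apply: sub_sigma_algebra2.
by apply: setUSS; [apply: setUSS|]; exact: sigma_process_sub.
Qed.

Lemma info_X a b c : sigma_process X a `<=` info a b c.
Proof. by move=> A GA; apply: sub_sigma_algebra; left; left. Qed.

Lemma info_xi a b c : sigma_process xi b `<=` info a b c.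
Proof. by move=> A GA; apply: sub_sigma_algebra; left; right. Qed.

Lemma info_eta a b c : sigma_process eta c `<=` info a b c.
Proof. by move=> A GA; apply: sub_sigma_algebra; right. Qed.

Lemma infoI a b c A B : info a b c A -> info a b c B -> info a b c (A `&` B).
Proof. exact: g_sigma_algebraI. Qed.

Lemma info_measurable a b c : info a b c `<=` measurable.
Proof.
apply: g_sigma_algebra_sub => A [[|]|]; exact: sigma_process_measurable.
Qed.

Let TT : preimage_set_system setT T measurable setT.
Proof. by exists setT => //; rewrite setTI preimage_setT. Qed.

Let indep3 A1 A2 A3 : sigma_process X setT A1 -> sigma_process xi setT A2 ->
  sigma_process eta setT A3 -> mu (A1 `&` A2 `&` A3) = mu A1 * mu A2 * mu A3.
Proof.
move=> GA1 GA2 GA3.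
by have := indep GA1 GA2 GA3 TT; rewrite setIT probability_setT mule1.
Qed.

Let spT d1 (S : measurableType d1) (Y : nat -> {mfun Omega >-> S}) D A :
  sigma_process Y D A -> sigma_process Y setT A.
Proof. by apply: sigma_process_sub. Qed.

Lemma indep_info_T A B : info setT setT setT A ->
  mu (A `&` T @^-1` B) = mu A * mu (T @^-1` B).
Proof.
move=> GA.
apply: (@indep_generated _ _ _ mu (sigma_process X setT)
  (sigma_process xi setT) (sigma_process eta setT)) => //;
  do ?[exact: g_sigma_algebraT|exact: sigma_processI
      |exact: sigma_process_measurable].
  by rewrite -[X in measurable X]setTI; exact: (measurable_funPT T).
move=> A1 A2 A3 GA1 GA2 GA3.
rewrite indep// ?indep3//.
by exists B => //; rewrite setTI.
Qed.

Lemma indep_info_eta n A C : iid_uniform mu eta ->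
  info setT setT [set k | (k < n)%N] A -> measurable C ->
  mu (A `&` eta n @^-1` C) = mu A * uniform_prob (@ltr01 R) C.
Proof.
move=> iid GA mC.
have muC : mu (eta n @^-1` C) = uniform_prob (@ltr01 R) C by exact: iid.1.
rewrite -muC.
apply: (@indep_generated _ _ _ mu (sigma_process X setT)
  (sigma_process xi setT) (sigma_process eta [set k | (k < n)%N])) => //;
  do ?[exact: g_sigma_algebraT|exact: sigma_processI
      |exact: sigma_process_measurable].
  by rewrite -[X in measurable X]setTI; exact: (measurable_funPT (eta n)).
move=> A1 A2 A3 GA1 GA2 GA3.
have GA3T : sigma_process eta setT A3 by exact: spT GA3.
rewrite -setIA indep3//; last first.
  by apply: g_sigma_algebraI => //; exact: sigma_process_preimage.
by rewrite iid_past_indep// muC indep3// muleA.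
Qed.

Section transition.
Variable Pi : R.-pker E ~> E.
Hypothesis markov : forall (n : nat) (A : set Omega) (B : set E),
  sigma_process X [set k | (k <= n)%N] A -> measurable B ->
  mu (A `&` X n.+1 @^-1` B) = \int[mu]_(w in A) Pi (X n w) B.

(** The Markov property survives the disclosure of all randomization devices,
    because these are independent of the process. *)
Lemma markov_info n A B : info [set k | (k <= n)%N] setT setT A ->
  measurable B ->
  mu (A `&` X n.+1 @^-1` B) = \int[mu]_(w in A) Pi (X n w) B.
Proof.
move=> GA mB.
have mXB : measurable (X n.+1 @^-1` B).
  by rewrite -[X in measurable X]setTI; exact: (measurable_funPT (X n.+1)).
have mPi : measurable_fun setT (fun y => Pi y B) by exact: measurable_kernel.
have mf : measurable_fun setT (fun w => Pi (X n w) B).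
  by apply: (measurableT_comp (f := fun y => Pi y B)).
have f0 w : 0 <= Pi (X n w) B by exact: measure_ge0.
suff : mrestr mu mXB A = density mu mf f0 A by [].
apply: (@measure_unique_rectangles _ _ _ (sigma_process X [set k | (k <= n)%N])
  (sigma_process xi setT) (sigma_process eta setT)) => //;
  do ?[exact: g_sigma_algebraT|exact: sigma_processI
      |exact: sigma_process_measurable].
  by rewrite /= /mrestr setTI ltey_eq fin_num_measure.
move=> A1 A2 A3 GA1 GA2 GA3; rewrite /= /mrestr /density.
have GA1T : sigma_process X setT A1 by exact: spT GA1.
have mA1 : measurable A1 by exact: sigma_process_measurable GA1.
have mA2 : measurable A2 by exact: sigma_process_measurable GA2.
have mA3 : measurable A3 by exact: sigma_process_measurable GA3.
have rect A' : sigma_process X setT A' ->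
    mu (A' `&` A2 `&` A3) = (fine (mu A2 * mu A3))%:E * mu A'.
  move=> ?; rewrite indep3// fineK; last by rewrite fin_numM// fin_num_measure.
  by rewrite -muleA muleC.
have pre k C : measurable C -> sigma_process X setT (X k @^-1` C).
  by move=> mC; exact: sigma_process_preimage.
rewrite (setIAC _ A3) (setIAC _ A2) rect; last first.
  by apply: g_sigma_algebraI => //; exact: pre.
rewrite markov//; apply/esym.
apply: (integral_comp_scale (v := fun y => Pi y B)) => //.
- by apply: measurableI => //; exact: measurableI.
- by rewrite fine_ge0// mule_ge0.
- move=> C mC.
  rewrite (setIAC _ A3) (setIAC _ A2); apply: rect.
  by apply: g_sigma_algebraI => //; exact: pre.
Qed.

Lemma integral_transition n A (v : E -> \bar R) :
  info [set k | (k <= n)%N] setT setT A ->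
  (forall y, 0 <= v y) -> measurable_fun setT v ->
  \int[mu]_(w in A) v (X n.+1 w) =
  \int[mu]_(w in A) \int[Pi (X n w)]_y v y.
Proof.
move=> GA v0 mv.
apply: (@integral_comp_kernel _ _ _ _ _ _ A (X n.+1) (X n)) => //.
- exact: info_measurable GA.
- by move=> B mB; exact: markov_info.
Qed.

End transition.

Section thinning.
Variables (n : nat) (A : set Omega) (q : E -> R) (v : E -> \bar R).
Hypotheses (eta_iid : iid_uniform mu eta)
  (GA : info setT setT [set k | (k < n)%N] A)
  (mq : measurable_fun setT q) (q01 : forall y, (0 <= q y <= 1)%R)
  (v0 : forall y, 0 <= v y) (mv : measurable_fun setT v).

Let mA : measurable A. Proof. exact: info_measurable GA. Qed.

(** Given the information in [A], the draw [eta n] is still uniform, so an event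
    on [eta n] acts as a multiplication by its conditional probability. *)
Let thinning (b : E -> R -> bool) :
  measurable [set z : E * R | b z.1 z.2] ->
  \int[mu]_(w in A `&` [set w | b (X n w) (eta n w)]) v (X n w) =
  \int[mu]_(w in A) (uniform_prob (@ltr01 R) [set u | b (X n w) u] * v (X n w)).
Proof.
move=> mbB; rewrite integral_mkcondr.
pose F (z : E * R) := v z.1 * (b z.1 z.2)%:R%:E.
have F0 z : 0 <= F z by rewrite mule_ge0// lee_fin.
have bE z : (b z.1 z.2)%:R = \1_([set z | b z.1 z.2]) z :> R.
  by rewrite indicE; congr ((nat_of_bool _)%:R : R); apply/idP/idP; rewrite inE.
have mF : measurable_fun setT F.
  apply: emeasurable_funM; first exact: measurableT_comp.
  under eq_fun do rewrite bE.
  exact/measurable_EFinP/measurable_indic.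
transitivity (\int[mu]_(w in A) F (X n w, eta n w)).
  apply: eq_integral => w _; rewrite patchE /F/=.
  case: (boolP (b (X n w) (eta n w))) => bw.
    by rewrite mem_set// mule1.
  by rewrite memNset ?mule0//; exact/negP.
rewrite (@integral_indep_coordinate _ _ _ _ _ _ _ mu (uniform_prob (@ltr01 R)) A
  (X n) (eta n) F) //; last first.
  move=> B C mB mC; apply: (indep_info_eta (n := n)) => //.
  apply: g_sigma_algebraI => //; apply: info_X.
  exact: sigma_process_preimage.
- exact: (measurable_funPT (eta n)).
apply: eq_integral => w _; rewrite /F/=.
have mbw : measurable [set u | b (X n w) u].
  have mp : measurable_fun setT (fun u : R => (X n w, u)).
    exact: measurable_fun_pair.
  by rewrite -[X in measurable X]setTI; exact: (mp measurableT _ mbB).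
have b1E u : (b (X n w) u)%:R = \1_([set u | b (X n w) u]) u :> R.
  by rewrite indicE; congr ((nat_of_bool _)%:R : R); apply/idP/idP; rewrite inE.
under eq_integral => u _ do rewrite b1E.
rewrite ge0_integralZl//; first by rewrite integral_indic// setIT muleC.
exact/measurable_EFinP/measurable_indic.
Qed.

Let measurable_le : measurable [set z : E * R | (z.2 <= q z.1)%R].
Proof.
have := @measurable_fun_le _ (E * R)%type R setT (fun z => z.2)
  (fun z => q z.1) measurableT measurable_snd.
by rewrite setTI; apply; exact: measurableT_comp.
Qed.

Lemma integral_stop :
  \int[mu]_(w in A `&` [set w | (eta n w <= q (X n w))%R]) v (X n w) =
  \int[mu]_(w in A) ((q (X n w))%:E * v (X n w)).
Proof.
rewrite (thinning (b := fun y u => (u <= q y)%R))//.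
by apply: eq_integral => w _; rewrite uniform_le.
Qed.

Lemma integral_continue :
  \int[mu]_(w in A `&` [set w | (q (X n w) < eta n w)%R]) v (X n w) =
  \int[mu]_(w in A) ((1 - q (X n w))%:E * v (X n w)).
Proof.
rewrite (thinning (b := fun y u => (q y < u)%R)); last first.
  rewrite (_ : [set z | _] = ~` [set z : E * R | (z.2 <= q z.1)%R]).
    exact: measurableC.
  by apply/seteqP; split => z /=; rewrite ltNge => /negP.
by apply: eq_integral => w _; rewrite uniform_gt.
Qed.

End thinning.
End noise.

(** * Stopping times *)

Section times.
Context (Omega : Type).
Implicit Types (tau : Omega -> option nat) (n : nat).

Definition stop_at tau n : set Omega := [set w | tau w = Some n].

(** The play is not over before time [n]; it may stop at [n] itself. *)
Definition alive tau n : set Omega :=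
  [set w | forall k, (k < n)%N -> tau w <> Some k].

Lemma alive0 tau : alive tau 0 = setT.
Proof. by apply/seteqP; split => // w _ k. Qed.

Lemma aliveS tau n : alive tau n.+1 = alive tau n `\` stop_at tau n.
Proof.
apply/seteqP; split => w.
  move=> tw; split; last exact: tw.
  by move=> k kn; apply: tw; exact: ltnW.
move=> [tw tnw] k; rewrite ltnS leq_eqVlt => /predU1P[->|]; first exact: tnw.
exact: tw.
Qed.

Lemma stop_at_alive tau n : stop_at tau n `<=` alive tau n.
Proof. by move=> w tw k kn; rewrite tw => -[nk]; rewrite nk ltnn in kn. Qed.

Lemma alive_split tau n : alive tau n = stop_at tau n `|` alive tau n.+1.
Proof. by rewrite aliveS setDUK//; exact: stop_at_alive. Qed.

End times.

Section markovian_times.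
Context (R : realType) (Omega F : Type) (Y : nat -> Omega -> F)
  (xi : nat -> Omega -> R) (p : F -> R).
Local Notation tau := (markovian_time Y xi p).

Lemma markovian_timeP n w : tau w = Some n <->
  (xi n w <= p (Y n w))%R /\ forall k, (k < n)%N -> (p (Y k w) < xi k w)%R.
Proof.
rewrite /markovian_time; case: pselect => [ex|nex]; last first.
  by split=> // -[xn _]; exfalso; apply: nex; exists n.
case: ex_minnP => m xm min_m; split.
  move=> [<-]; split => // k km; rewrite ltNge; apply/negP => /min_m.
  by rewrite leqNgt km.
move=> [xn ltn]; congr Some; apply/eqP; rewrite eqn_leq min_m//=.
by rewrite leqNgt; apply/negP => /ltn; rewrite ltNge xm.
Qed.

Lemma alive_markovian n :
  alive tau n = [set w | forall k, (k < n)%N -> (p (Y k w) < xi k w)%R].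
Proof.
elim: n => [|n IHn]; first by rewrite alive0; apply/seteqP; split.
rewrite aliveS IHn; apply/seteqP; split => w.
  move=> [lt_n tn] k; rewrite ltnS leq_eqVlt => /predU1P[->|]; last exact: lt_n.
  rewrite ltNge; apply/negP => xn; apply: tn; exact/markovian_timeP.
move=> lt_n; split; first by move=> k kn; apply: lt_n; exact: ltnW.
by move=> /markovian_timeP[xn _]; have := lt_n n (leqnn _); rewrite ltNge xn.
Qed.

Lemma stop_at_markovian n :
  stop_at tau n = alive tau n `&` [set w | (xi n w <= p (Y n w))%R].
Proof.
rewrite alive_markovian; apply/seteqP; split => w.
  by move=> /markovian_timeP[].
by move=> [lt_n xn]; apply/markovian_timeP.
Qed.

Lemma aliveS_markovian n :
  alive tau n.+1 = alive tau n `&` [set w | (p (Y n w) < xi n w)%R].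
Proof.
rewrite aliveS stop_at_markovian setDE setCI setIUr setICr set0U.
by congr (_ `&` _); apply/seteqP; split => w /=; rewrite ltNge => /negP.
Qed.

End markovian_times.

Section adapted.
Context d d' (E : measurableType d) (Omega : measurableType d') (R : realType)
  (X : nat -> {mfun Omega >-> E}).
Implicit Types (tau : Omega -> option nat) (n : nat).

Lemma filtration_info (xi eta : nat -> {mfun Omega >-> R}) n c :
  filtration X xi n `<=`
  info X xi eta [set k | (k <= n)%N] [set k | (k <= n)%N] c.
Proof. by apply: sub_sigma_algebra2 => A; left. Qed.

Lemma filtration_mono (xi : nat -> {mfun Omega >-> R}) m n : (m <= n)%N ->
  filtration X xi m `<=` filtration X xi n.
Proof.
move=> mn; apply: sub_sigma_algebra2; apply: setUSS; apply: sigma_process_sub;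
  by move=> k /= /leq_trans; apply.
Qed.

Lemma stopping_alive (xi : nat -> {mfun Omega >-> R}) tau n :
  stopping_times X xi tau -> filtration X xi n (alive tau n.+1).
Proof.
move=> st; rewrite (_ : alive _ _ =
    ~` [set w | exists2 k, (k <= n)%N & tau w = Some k]).
  by apply: g_sigma_algebraC; exact: st.
apply/seteqP; split => w.
  by move=> tw [k kn]; exact: tw.
by move=> tw k kn twk; apply: tw; exists k.
Qed.

Lemma stopping_stop_at (xi : nat -> {mfun Omega >-> R}) tau n :
  stopping_times X xi tau -> filtration X xi n (stop_at tau n).
Proof.
move=> st.
have an : filtration X xi n (alive tau n).
  case: n => [|n]; first by rewrite alive0; exact: g_sigma_algebraT.
  by apply: (@filtration_mono xi n) => //; exact: stopping_alive.
rewrite (_ : stop_at tau n = alive tau n `\` alive tau n.+1).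
  by apply: g_sigma_algebraD => //; exact: stopping_alive.
by rewrite aliveS setDD setIidr//; exact: stop_at_alive.
Qed.

Lemma stop_event (xi : nat -> {mfun Omega >-> R}) (p : E -> R) n
    (G : set (set Omega)) :
  measurable_fun setT p ->
  (forall B, measurable B -> <<s G >> (X n @^-1` B)) ->
  (forall B, measurable B -> <<s G >> (xi n @^-1` B)) ->
  <<s G >> [set w | (xi n w <= p (X n w))%R].
Proof.
move=> mp GX Gxi; apply: g_sigma_algebra_le => // B mB.
rewrite (_ : _ @^-1` _ = X n @^-1` (p @^-1` B))//; apply: GX.
by rewrite -[X in measurable X]setTI; exact: mp.
Qed.

Lemma lt_setC (xi : nat -> Omega -> R) (p : nat -> Omega -> R) n :
  [set w | (p n w < xi n w)%R] = ~` [set w | (xi n w <= p n w)%R].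
Proof. by apply/seteqP; split => w /=; rewrite ltNge => /negP. Qed.

(** The Markovian time of the space-time process. Time dependence is what makes
    a deviation in the first period only a time of this kind. *)
Definition inhomogeneous_time (xi : nat -> Omega -> R) (p : nat -> E -> R) :
    Omega -> option nat :=
  markovian_time (fun n w => (n, X n w)) xi (fun z => p z.1 z.2).

Lemma inhomogeneous_timeE (xi : nat -> Omega -> R) (p : E -> R) :
  inhomogeneous_time xi (fun=> p) = markovian_time X xi p.
Proof. by []. Qed.

Lemma inhomogeneous_alive (xi : nat -> {mfun Omega >-> R}) (p : nat -> E -> R)
    (G : set (set Omega)) n :
  (forall k, measurable_fun setT (p k)) ->
  (forall k B, (k < n)%N -> measurable B -> <<s G >> (X k @^-1` B)) ->
  (forall k B, (k < n)%N -> measurable B -> <<s G >> (xi k @^-1` B)) ->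
  <<s G >> (alive (inhomogeneous_time xi p) n).
Proof.
move=> mp; elim: n => [_ _|n IHn GX Gxi].
  by rewrite alive0; exact: g_sigma_algebraT.
rewrite aliveS_markovian; apply: g_sigma_algebraI.
  by apply: IHn => k B kn; [apply: GX|apply: Gxi]; exact: ltnW.
rewrite (lt_setC xi (fun n w => p n (X n w))); apply: g_sigma_algebraC.
by apply: stop_event => // B; [exact: GX|exact: Gxi].
Qed.

Lemma inhomogeneous_stopping (xi : nat -> {mfun Omega >-> R})
    (p : nat -> E -> R) :
  (forall k, measurable_fun setT (p k)) ->
  stopping_times X xi (inhomogeneous_time xi p).
Proof.
move=> mp n; rewrite (_ : [set w | _] =
    ~` alive (inhomogeneous_time xi p) n.+1).
  apply: g_sigma_algebraC; apply: inhomogeneous_alive => // k B kn mB;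
    apply: sub_sigma_algebra.
    by left; exact: sigma_process_preimage.
  by right; exact: sigma_process_preimage.
apply/seteqP; split => w /=.
  by move=> [k kn tk] /(_ k kn).
by move=> /existsNP[k /not_implyP[kn /contrapT]]; exists k.
Qed.

End adapted.

(** * One period of the game *)

(** The discounted value at time [n] of the payoff [v], collected on [A]. It is
    locked because additive rewriting in the extended reals would otherwise
    unfold the integral into a difference. *)
HB.lock Definition pay d d' (E : measurableType d) (Omega : measurableType d')
  (R : realType) (mu : probability Omega R) (X : nat -> {mfun Omega >-> E})
  (alpha : R) (A : set Omega) (n : nat) (v : E -> \bar R) : \bar R :=
  \int[mu]_(w in A) ((alpha ^+ n)%:E * v (X n w)).

(** The setting seen by one player, under one starting law: [xi] is the own
    randomization device and [eta] that of the opponent. *)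
Record randomized_model d d' (E : measurableType d) (Omega : measurableType d')
    (R : realType) (mu : probability Omega R) (X : nat -> {mfun Omega >-> E})
    (xi eta : nat -> {mfun Omega >-> R}) (T : {mfun Omega >-> nat})
    (Pi : R.-pker E ~> E) (alpha : R) : Prop := RandomizedModel {
  model_indep : independent4 mu (sigma_process X setT)
    (sigma_process xi setT) (sigma_process eta setT)
    (preimage_set_system setT T measurable) ;
  model_markov : forall (n : nat) (A : set Omega) (B : set E),
    sigma_process X [set k | (k <= n)%N] A -> measurable B ->
    mu (A `&` X n.+1 @^-1` B) = \int[mu]_(w in A) Pi (X n w) B ;
  model_own : iid_uniform mu xi ;
  model_opponent : iid_uniform mu eta ;
  model_killing : killing_time mu alpha T ;
  model_discount : (0 < alpha < 1)%R }.

Lemma addeAC_swap (R : realType) (a b c e : \bar R) :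
  a + b + c + e = a + c + (e + b).
Proof. by rewrite (addeAC a) -(addeA (a + c)) (addeC b). Qed.

Section model_theory.
Context d d' (E : measurableType d) (Omega : measurableType d') (R : realType)
  (mu : probability Omega R) (X : nat -> {mfun Omega >-> E}).
Implicit Types (xi eta : nat -> {mfun Omega >-> R}).

(** Whatever is proved for one player holds for the other one. *)
Lemma randomized_model_swap xi eta (T : {mfun Omega >-> nat})
    (Pi : R.-pker E ~> E) (alpha : R) :
  randomized_model mu X xi eta T Pi alpha ->
  randomized_model mu X eta xi T Pi alpha.
Proof.
case=> indep ? ? ? ? ?; split => // A1 A2 A3 A4 G1 G2 G3 G4.
by rewrite (setIAC A1) indep// (muleAC (mu A1)).
Qed.

Lemma info_swap xi eta a b c A : info X xi eta a b c A -> info X eta xi a c b A.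
Proof. by apply: sub_sigma_algebra2 => B; rewrite setUAC. Qed.

End model_theory.

Section nonnegative_payoffs.
Context d (E : measurableType d) (R : realType) (Pi : R.-pker E ~> E).
Implicit Types (u v : E -> \bar R).

(** Payoffs take values in [0, +oo], where integrals are always defined and
    additive; signed rewards are handled through their two parts. *)
Definition payoff v := measurable_fun setT v /\ forall y, 0 <= v y.

Lemma payoffD u v : payoff u -> payoff v -> payoff (fun y => u y + v y).
Proof.
move=> [mu' u0] [mv v0]; split; first exact: emeasurable_funD.
by move=> y; exact: adde_ge0.
Qed.

Lemma payoffM u v : payoff u -> payoff v -> payoff (fun y => u y * v y).
Proof.
move=> [mu' u0] [mv v0]; split; first exact: emeasurable_funM.
by move=> y; exact: mule_ge0.
Qed.

Lemma payoff_cst (r : R) : (0 <= r)%R -> payoff (fun=> r%:E).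
Proof. by move=> r0; split => // y; rewrite lee_fin. Qed.

Lemma payoff_EFin (r : E -> R) : measurable_fun setT r ->
  (forall y, 0 <= r y)%R -> payoff (EFin \o r).
Proof. by move=> mr r0; split => //; exact/measurable_EFinP. Qed.

Lemma payoff_kernel u : payoff u -> payoff (fun y => \int[Pi y]_z u z).
Proof.
move=> [mu' u0]; split; last by move=> y; exact: integral_ge0.
apply: measurable_fun_integral_kernel => // U mU; exact: measurable_kernel.
Qed.

Lemma payoff_prob (r : E -> R) : measurable_fun setT r ->
  (forall y, (0 <= r y <= 1)%R) ->
  payoff (fun y => (r y)%:E) /\ payoff (fun y => (1 - r y)%:E).
Proof.
move=> mr r01; split; split.
- exact/measurable_EFinP.
- by move=> y; rewrite lee_fin; case/andP: (r01 y).
- by apply/measurable_EFinP; exact: measurable_funB.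
- by move=> y; rewrite lee_fin subr_ge0; case/andP: (r01 y).
Qed.

End nonnegative_payoffs.

Section player.
Context d d' (E : measurableType d) (Omega : measurableType d') (R : realType).
Variables (mu : probability Omega R) (X : nat -> {mfun Omega >-> E})
  (xi eta : nat -> {mfun Omega >-> R}) (T : {mfun Omega >-> nat})
  (Pi : R.-pker E ~> E) (alpha : R) (q : E -> R).
Hypotheses (model : randomized_model mu X xi eta T Pi alpha)
  (mq : measurable_fun setT q) (q01 : forall y, (0 <= q y <= 1)%R).
Implicit Types (A : set Omega) (f g h u v : E -> \bar R) (n : nat).

Let indep := model_indep model.
Let markov := model_markov model.
Let eta_iid := model_opponent model.
Let alpha0 : (0 <= alpha)%R.
Proof. by case/andP: (model_discount model) => /ltW. Qed.

(** The expected payoffs of stopping and of continuing in state [y], against an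
    opponent who stops there with probability [q y]; [u] is what a continued
    play is worth one period later. *)
Definition stop_value f h y := (1 - q y)%:E * f y + (q y)%:E * h y.

Definition cont_value g u y :=
  (1 - q y)%:E * (alpha%:E * \int[Pi y]_z u z) + (q y)%:E * g y.

Let payoffq : payoff (fun y => (q y)%:E).
Proof. exact: (payoff_prob mq q01).1. Qed.

Let payoff1q : payoff (fun y => (1 - q y)%:E).
Proof. exact: (payoff_prob mq q01).2. Qed.

Lemma payoff_stop_value f h : payoff f -> payoff h -> payoff (stop_value f h).
Proof. by move=> gf gh; apply: payoffD; exact: payoffM. Qed.

Lemma payoff_cont_value g u : payoff g -> payoff u -> payoff (cont_value g u).
Proof.
move=> gg gu; apply: payoffD; last exact: payoffM.
apply: payoffM => //; apply: payoffM; first exact: payoff_cst.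
exact: payoff_kernel.
Qed.

Local Notation pay := (pay mu X alpha).

Let an0 n : (0 <= alpha ^+ n)%R. Proof. exact: exprn_ge0. Qed.

Lemma payoff_scale n v : payoff v -> payoff (fun y => (alpha ^+ n)%:E * v y).
Proof. by move=> gv; apply: payoffM => //; exact: payoff_cst. Qed.

Lemma payoff_comp n v D : payoff v -> measurable_fun D (fun w => v (X n w)).
Proof.
move=> [mv _]; apply: measurable_funTS.
by apply: (measurableT_comp (f := v)).
Qed.

Lemma pay_ge0 A n v : payoff v -> 0 <= pay A n v.
Proof.
by move=> /(payoff_scale n)[_ v0]; rewrite pay.unlock; exact: integral_ge0.
Qed.

Lemma payD A n u v : measurable A -> payoff u -> payoff v ->
  pay A n (fun y => u y + v y) = pay A n u + pay A n v.
Proof.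
move=> mA gu gv; rewrite pay.unlock -ge0_integralD//.
- by apply: eq_integral => w _; rewrite ge0_muleDr//; [case: gu|case: gv].
- by move=> w _; apply: (payoff_scale n gu).2.
- exact: payoff_comp (payoff_scale n gu).
- by move=> w _; apply: (payoff_scale n gv).2.
- exact: payoff_comp (payoff_scale n gv).
Qed.

Lemma pay_setU A B n v : measurable A -> measurable B -> payoff v ->
  A `&` B = set0 -> pay (A `|` B) n v = pay A n v + pay B n v.
Proof.
move=> mA mB gv AB; rewrite pay.unlock ge0_integral_setU//.
- exact: payoff_comp (payoff_scale n gv).
- by move=> w _; apply: (payoff_scale n gv).2.
- by apply/disj_setPS; rewrite AB.
Qed.

Lemma le_pay A n u v : measurable A -> payoff u -> payoff v ->
  (forall y, u y <= v y) -> pay A n u <= pay A n v.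
Proof.
move=> mA gu gv uv; rewrite pay.unlock; apply: ge0_le_integral => //.
- by move=> w _; apply: (payoff_scale n gu).2.
- exact: payoff_comp (payoff_scale n gu).
- exact: payoff_comp (payoff_scale n gv).
- by move=> w _; apply: lee_wpmul2l => //; rewrite lee_fin.
Qed.

(** One step of the process costs one factor [alpha]. *)
Lemma pay_transition A n u :
  info X xi eta [set k | (k <= n)%N] setT setT A -> payoff u ->
  pay A n.+1 u = pay A n (fun y => alpha%:E * \int[Pi y]_z u z).
Proof.
move=> GA gu; have [ms s0] := payoff_scale n.+1 gu; have [mu' u0] := gu.
rewrite pay.unlock (integral_transition indep markov GA s0 ms).
apply: eq_integral => w _.
rewrite ge0_integralZl ?lee_fin//.
by rewrite exprSr EFinM muleA.
Qed.

Lemma pay_stop A n v : info X xi eta setT setT [set k | (k < n)%N] A ->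
  payoff v -> pay (A `&` [set w | (eta n w <= q (X n w))%R]) n v =
  pay A n (fun y => (q y)%:E * v y).
Proof.
move=> GA gv; have [ms s0] := payoff_scale n gv.
rewrite pay.unlock (integral_stop indep eta_iid GA mq q01 s0 ms).
by apply: eq_integral => w _; rewrite muleCA.
Qed.

Lemma pay_continue A n v : info X xi eta setT setT [set k | (k < n)%N] A ->
  payoff v -> pay (A `&` [set w | (q (X n w) < eta n w)%R]) n v =
  pay A n (fun y => (1 - q y)%:E * v y).
Proof.
move=> GA gv; have [ms s0] := payoff_scale n gv.
rewrite pay.unlock (integral_continue indep eta_iid GA mq q01 s0 ms).
by apply: eq_integral => w _; rewrite muleCA.
Qed.

Section against_time.
Variable tau : Omega -> option nat.
Hypothesis tau_stop : stopping_times X xi tau.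
Local Notation sigma := (markovian_time X eta q).

Definition both_alive n := alive tau n `&` alive sigma n.

(** The part of the reward that falls due at time [n]. *)
Definition collected n f g h :=
  pay (stop_at tau n `&` alive sigma n.+1) n f +
  pay (alive tau n.+1 `&` stop_at sigma n) n g +
  pay (stop_at tau n `&` stop_at sigma n) n h.

Lemma collected_ge0 n f g h : payoff f -> payoff g -> payoff h ->
  0 <= collected n f g h.
Proof. by move=> gf gg gh; rewrite !adde_ge0// pay_ge0. Qed.

Let info_sigma n : info X xi eta [set k | (k < n)%N] setT [set k | (k < n)%N]
  (alive sigma n).
Proof.
rewrite -(inhomogeneous_timeE X eta q); apply: inhomogeneous_alive => //.
  by move=> k B kn mB; apply: info_X; exact: sigma_process_preimage.
by move=> k B kn mB; apply: info_eta; exact: sigma_process_preimage.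
Qed.

Lemma info_stop n : info X xi eta setT setT [set k | (k < n)%N]
  (stop_at tau n `&` alive sigma n).
Proof.
apply: infoI; last by apply: (info_widen (@info_sigma n)).
by apply: (info_widen (filtration_info (c := [set k | (k < n)%N])
  (stopping_stop_at tau_stop))).
Qed.

Lemma info_go n : info X xi eta setT setT [set k | (k < n)%N]
  (alive tau n.+1 `&` alive sigma n).
Proof.
apply: infoI; last by apply: (info_widen (@info_sigma n)).
by apply: (info_widen (filtration_info (c := [set k | (k < n)%N])
  (stopping_alive tau_stop))).
Qed.

Lemma info_both_aliveS n :
  info X xi eta [set k | (k <= n)%N] setT setT (both_alive n.+1).
Proof.
apply: infoI.
  by apply: (info_widen (filtration_info (c := setT)
    (stopping_alive tau_stop))).
by apply: (info_widen (@info_sigma n.+1)).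
Qed.

Lemma info_both_alive n : info X xi eta setT setT setT (both_alive n).
Proof.
case: n => [|n]; last by apply: (info_widen (@info_both_aliveS n)).
by rewrite /both_alive !alive0 setTI; exact: g_sigma_algebraT.
Qed.

(** The central identity. If play has reached time [n], then whether the own
    time stops at [n] is known before the opponent's draw at [n]; integrating
    out that draw, and then the next state, turns the reward due at [n]
    together with a continuation payoff [u] into [stop_value] or [cont_value].
    *)
Lemma one_step n f g h u : payoff f -> payoff g -> payoff h -> payoff u ->
  collected n f g h + pay (both_alive n.+1) n.+1 u =
  pay (stop_at tau n `&` alive sigma n) n (stop_value f h) +
  pay (alive tau n.+1 `&` alive sigma n) n (cont_value g u).
Proof.
move=> gf gg gh gu.
have gPu : payoff (fun y => alpha%:E * \int[Pi y]_z u z).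
  by apply: payoffM; [exact: payoff_cst|exact: payoff_kernel].
have iS : info X xi eta setT setT [set k | (k < n)%N]
  (stop_at tau n `&` alive sigma n) by exact: info_stop.
have iG : info X xi eta setT setT [set k | (k < n)%N]
  (alive tau n.+1 `&` alive sigma n) by exact: info_go.
rewrite (pay_transition (@info_both_aliveS n))// /collected /both_alive.
rewrite !stop_at_markovian !aliveS_markovian !setIA.
rewrite !pay_stop// !pay_continue//.
rewrite /stop_value /cont_value !payD//; do ?exact: payoffM;
  do ?[exact: info_measurable iS|exact: info_measurable iG].
exact: addeAC_swap.
Qed.

End against_time.
End player.

Section markovian_play.
Context d d' (E : measurableType d) (Omega : measurableType d') (R : realType).
Variables (mu : probability Omega R) (X : nat -> {mfun Omega >-> E})
  (xi eta : nat -> {mfun Omega >-> R}) (T : {mfun Omega >-> nat})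
  (Pi : R.-pker E ~> E) (alpha : R) (q : E -> R) (p : nat -> E -> R).
Hypotheses (model : randomized_model mu X xi eta T Pi alpha)
  (mq : measurable_fun setT q) (q01 : forall y, (0 <= q y <= 1)%R)
  (mp : forall n, measurable_fun setT (p n))
  (p01 : forall n y, (0 <= p n y <= 1)%R).
Implicit Types (f g h u v : E -> \bar R) (n : nat).

Local Notation tau := (inhomogeneous_time X xi p).
Local Notation sigma := (markovian_time X eta q).

(** The value of playing [r] now, if a continued play is worth [u]. *)
Definition bellman (r : E -> R) f g h u y :=
  (r y)%:E * stop_value q f h y + (1 - r y)%:E * cont_value Pi alpha q g u y.

Lemma info_both_alive_markovian n :
  info X xi eta [set k | (k < n)%N] [set k | (k < n)%N] [set k | (k < n)%N]
    (both_alive X eta q tau n).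
Proof.
apply: infoI.
  apply: inhomogeneous_alive => // k B kn mB.
    by apply: info_X; exact: sigma_process_preimage.
  by apply: info_xi; exact: sigma_process_preimage.
rewrite -(inhomogeneous_timeE X eta q); apply: inhomogeneous_alive => //.
  by move=> k B kn mB; apply: info_X; exact: sigma_process_preimage.
by move=> k B kn mB; apply: info_eta; exact: sigma_process_preimage.
Qed.

(** When the own time is Markovian as well, the own draw at [n] can be
    integrated out too, by exchanging the roles of the players. *)
Lemma one_step_markovian n f g h u :
  payoff f -> payoff g -> payoff h -> payoff u ->
  collected mu X eta alpha q tau n f g h +
    pay mu X alpha (both_alive X eta q tau n.+1) n.+1 u =
  pay mu X alpha (both_alive X eta q tau n) n (bellman (p n) f g h u).
Proof.
move=> gf gg gh gu.
have gS := payoff_stop_value mq q01 gf gh.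
have gC := payoff_cont_value model mq q01 gg gu.
have GI : info X eta xi setT setT [set k | (k < n)%N]
    (both_alive X eta q tau n).
  apply: info_swap.
  exact: (info_widen (@info_both_alive_markovian n)).
have st : stopping_times X xi tau by exact: inhomogeneous_stopping.
rewrite (one_step model mq q01 st)//.
have -> : stop_at tau n `&` alive sigma n =
    both_alive X eta q tau n `&` [set w | (xi n w <= p n (X n w))%R].
  by rewrite stop_at_markovian setIAC.
have -> : alive tau n.+1 `&` alive sigma n =
    both_alive X eta q tau n `&` [set w | (p n (X n w) < xi n w)%R].
  by rewrite aliveS_markovian setIAC.
have model' := randomized_model_swap model.
rewrite (pay_stop model' (mp n) (p01 n) GI gS).
rewrite (pay_continue model' (mp n) (p01 n) GI gC).
have [gp gp'] := payoff_prob (mp n) (p01 n).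
have mA : measurable (both_alive X eta q tau n) by exact: info_measurable GI.
by rewrite /bellman (payD model)//; exact: payoffM.
Qed.

Lemma payoff_bellman n f g h u : payoff f -> payoff g -> payoff h -> payoff u ->
  payoff (bellman (p n) f g h u).
Proof.
move=> gf gg gh gu; have [gp gp'] := payoff_prob (mp n) (p01 n).
apply: payoffD; apply: payoffM => //; first exact: payoff_stop_value.
exact: (payoff_cont_value model mq q01 gg gu).
Qed.

(** The operators are composed with time [0] outermost: the state at time [0] is
    the argument of the result. *)
Fixpoint value_iteration f g h n u : E -> \bar R :=
  if n is m.+1 then value_iteration f g h m (bellman (p m) f g h u) else u.

Lemma sum_collected n f g h u : payoff f -> payoff g -> payoff h -> payoff u ->
  \sum_(k < n) collected mu X eta alpha q tau k f g h +
    pay mu X alpha (both_alive X eta q tau n) n u =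
  \int[mu]_w value_iteration f g h n u (X 0%N w).
Proof.
move=> gf gg gh; elim: n u => [|n IHn] u gu /=.
  rewrite big_ord0 add0e /both_alive !alive0 setTI pay.unlock expr0.
  by apply: eq_integral => w _; rewrite mul1e.
rewrite big_ord_recr/= -addeA one_step_markovian//.
by apply: IHn; exact: payoff_bellman.
Qed.

End markovian_play.

(** * The realized reward, period by period *)

Section realized_reward.
Context (R : realType) (Omega E : Type) (alpha : R) (X : nat -> Omega -> E).
Implicit Types (f g h : E -> R) (ti tj : Omega -> option nat) (n : nat).

(** The random variable whose expectation is the reward. *)
Definition realized f g h ti tj (w : Omega) : R :=
  (discounted alpha X f (ti w) w * (time_lt (ti w) (tj w))%:R
   + discounted alpha X g (tj w) w * (time_lt (tj w) (ti w))%:R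
   + discounted alpha X h (ti w) w
     * ((ti w == tj w) && time_lt (ti w) None)%:R)%R.

Lemma realized_first f g h ti tj n w :
  stop_at ti n w -> alive tj n.+1 w ->
  realized f g h ti tj w = (alpha ^+ n * f (X n w))%R.
Proof.
rewrite /realized /stop_at /mkset => -> aj.
case E' : (tj w) => [m|] /=; last by rewrite mulr1 mulr0 addr0 mulr0 addr0.
have nm : (n < m)%N.
  by rewrite ltnNge; apply/negP; rewrite -ltnS => /aj; rewrite E'.
rewrite nm ltnNge (ltnW nm) mulr1 mulr0 addr0.
by rewrite (_ : Some n == Some m = false) ?mulr0 ?addr0//; apply: ltn_eqF.
Qed.

Lemma realized_second f g h ti tj n w :
  alive ti n.+1 w -> stop_at tj n w ->
  realized f g h ti tj w = (alpha ^+ n * g (X n w))%R.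
Proof.
rewrite /realized /stop_at /mkset => ai ->.
case E' : (ti w) => [m|] /=; last by rewrite !mul0r add0r mulr1 addr0.
have nm : (n < m)%N.
  by rewrite ltnNge; apply/negP; rewrite -ltnS => /ai; rewrite E'.
rewrite nm ltnNge (ltnW nm) mulr1 mulr0 add0r.
by rewrite (_ : Some m == Some n = false) ?mulr0 ?addr0//; apply: gtn_eqF.
Qed.

Lemma realized_both f g h ti tj n w :
  stop_at ti n w -> stop_at tj n w ->
  realized f g h ti tj w = (alpha ^+ n * h (X n w))%R.
Proof.
rewrite /realized /stop_at /mkset => -> -> /=.
by rewrite ltnn eqxx !mulr0 !add0r mulr1.
Qed.

Lemma realized_never f g h ti tj w :
  ti w = None -> tj w = None -> realized f g h ti tj w = 0%R.
Proof. by rewrite /realized => -> ->; rewrite !mulr0 !addr0. Qed.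

Lemma realizedB f g h f' g' h' ti tj w :
  realized (fun y => f y - f' y)%R (fun y => g y - g' y)%R
    (fun y => h y - h' y)%R ti tj w =
  (realized f g h ti tj w - realized f' g' h' ti tj w)%R.
Proof.
rewrite /realized /discounted.
by case: (ti w) => [m|]; case: (tj w) => [n|]; rewrite /=; ring.
Qed.

Lemma realized_ge0 f g h ti tj w : (0 <= alpha)%R ->
  (forall y, 0 <= f y)%R -> (forall y, 0 <= g y)%R -> (forall y, 0 <= h y)%R ->
  (0 <= realized f g h ti tj w)%R.
Proof.
move=> a0 f0 g0 h0; rewrite /realized /discounted.
have d0 (v : E -> R) t : (forall y, 0 <= v y)%R ->
    (0 <= if t is Some n then alpha ^+ n * v (X n w) else 0)%R.
  by move=> v0; case: t => // n; rewrite mulr_ge0// exprn_ge0.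
by rewrite !addr_ge0// mulr_ge0// ?d0.
Qed.

End realized_reward.

Section play_cells.
Context (Omega : Type) (ti tj : Omega -> option nat).
Implicit Types n : nat.

(** The three ways in which the play can end at time [n], as disjoint cells on
    which [realized] is a discounted function of [X n]. *)
Definition play_stops n : set Omega :=
  (stop_at ti n `&` alive tj n.+1 `|` alive ti n.+1 `&` stop_at tj n) `|`
  (stop_at ti n `&` stop_at tj n).

Lemma play_stopsP n w : play_stops n w ->
  [/\ alive ti n w, alive tj n w & stop_at ti n w \/ stop_at tj n w].
Proof.
have aS t : alive t n.+1 w -> alive t n w by rewrite aliveS => -[].
have sA t : stop_at t n w -> alive t n w by apply: stop_at_alive.
by move=> [[[si /aS aj]|[/aS ai sj]]|[si sj]]; split; auto.
Qed.

Lemma trivIset_play_stops : trivIset setT play_stops.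
Proof.
have no m n w : (m < n)%N -> play_stops m w -> play_stops n w -> False.
  move=> mn /play_stopsP[_ _ sm] /play_stopsP[ai aj _].
  by case: sm => sm; [apply: (ai m)|apply: (aj m)].
apply/trivIsetP => m n _ _; rewrite neq_ltn => /orP[] mn.
  by apply/seteqP; split => // w [/no]; apply.
by apply/seteqP; split => // w [] /[swap] /no; apply.
Qed.

Lemma play_stops_never w : ~ (\bigcup_n play_stops n) w ->
  ti w = None /\ tj w = None.
Proof.
move=> nw; have nps n : ~ play_stops n w by move=> ?; apply: nw; exists n.
have [n] : exists n, alive ti n w /\ alive tj n w /\
    ((ti w = None /\ tj w = None) \/ stop_at ti n w \/ stop_at tj n w).
  have alE t m n : t w = Some m -> (n <= m)%N -> alive t n w.
    move=> tm nm k kn; rewrite tm => -[mk].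
    by move: kn; rewrite -mk ltnNge nm.
  have alN t n : t w = None -> alive t n w by move=> tN k _; rewrite tN.
  case Ei : (ti w) => [m|]; case Ej : (tj w) => [n|].
  - have [mn|nm] := leqP m n.
      exists m; split; [exact: alE Ei _|split; [exact: alE Ej _|]].
      by right; left.
    exists n; split; [exact: alE Ei (ltnW nm)|split; [exact: alE Ej _|]].
    by right; right.
  - by exists m; split; [exact: alE Ei _|split; [exact: alN|right; left]].
  - by exists n; split; [exact: alN|split; [exact: alE Ej _|right; right]].
  - by exists 0%N; split; [exact: alN|split; [exact: alN|left]].
move=> [ai [aj [//|st]]]; exfalso; apply: (nps n).
have aS t : alive t n w -> ~ stop_at t n w -> alive t n.+1 w.
  by rewrite aliveS.
have [si|nsi] := pselect (stop_at ti n w);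
  have [sj|nsj] := pselect (stop_at tj n w).
- by right.
- by left; left; split => //; exact: aS.
- by left; right; split => //; exact: aS.
- by case: st.
Qed.

End play_cells.

Section reward_series.
Context d d' (E : measurableType d) (Omega : measurableType d') (R : realType).
Variables (mu : probability Omega R) (X : nat -> {mfun Omega >-> E})
  (xi eta : nat -> {mfun Omega >-> R}) (T : {mfun Omega >-> nat})
  (Pi : R.-pker E ~> E) (alpha : R) (q : E -> R) (tau : Omega -> option nat).
Hypotheses (model : randomized_model mu X xi eta T Pi alpha)
  (mq : measurable_fun setT q) (tau_stop : stopping_times X xi tau).
Implicit Types (A : set Omega) (f g h v : E -> R) (n : nat).

Local Notation sigma := (markovian_time X eta q).
Local Notation pay := (pay mu X alpha).
Local Notation collected := (collected mu X eta alpha q tau).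
Local Notation both_alive := (both_alive X eta q tau).
Local Notation all_info := (info X xi eta setT setT setT).

Let alpha0 : (0 <= alpha)%R.
Proof. by case/andP: (model_discount model) => /ltW. Qed.

Let indep := model_indep model.

(** [P (T >= n) = P (T = n) + P (T >= n + 1)], and the geometric law gives the
    first term. *)
Lemma killing_tail n : mu (T @^-1` [set k | (n <= k)%N]) = (alpha ^+ n)%:E.
Proof.
have mT B : measurable (T @^-1` B).
  by rewrite -[X in measurable X]setTI; exact: (measurable_funPT T).
elim: n => [|n IHn].
  by rewrite (_ : T @^-1` _ = setT) ?probability_setT//; apply/seteqP; split.
have : mu (T @^-1` [set k | (n <= k)%N]) =
    mu (T @^-1` [set n]) + mu (T @^-1` [set k | (n.+1 <= k)%N]).
  rewrite -measureU//; last first.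
    by apply/seteqP; split => // w [/= ->]; rewrite ltnn.
  congr (mu _); apply/seteqP; split => w /=.
    by rewrite leq_eqVlt => /predU1P[|]; [left|right].
  by move=> [->//|/ltnW].
rewrite IHn (model_killing model n).
have : mu (T @^-1` [set k | (n.+1 <= k)%N]) \is a fin_num.
  exact: fin_num_measure.
case: (mu _) => // r _ [E1]; congr EFin.
by rewrite exprS; lra.
Qed.

Definition dominated v (Z : Omega -> \bar R) :=
  forall n w, (n <= T w)%N -> (v (X n w))%:E <= Z w.

(** Discounting is killing: [T] is independent of all that the players see, so
    the factor [alpha ^+ n] is the probability that the process is still alive
    at time [n]. *)
Lemma pay_killed A n (v : E -> \bar R) : all_info A -> payoff v ->
  pay A n v = \int[mu]_(w in A `&` [set w | (n <= T w)%N]) v (X n w).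
Proof.
move=> GA [mv v0]; rewrite pay.unlock.
have mA : measurable A by exact: info_measurable GA.
have mTn : measurable [set w | (n <= T w)%N].
  rewrite -[X in measurable X]setTI.
  exact: (measurable_funPT T measurableT [set k | (n <= k)%N]).
rewrite (integral_comp_scale (A := A)
  (A' := A `&` [set w | (n <= T w)%N]) (v := v) (c := alpha ^+ n))//.
- rewrite ge0_integralZl ?lee_fin ?exprn_ge0//.
  by apply: measurable_funTS; apply: (measurableT_comp (f := v)).
- exact: measurableI.
- by rewrite exprn_ge0.
move=> B mB.
have GAB : all_info (A `&` X n @^-1` B).
  by apply: infoI => //; apply: info_X; exact: sigma_process_preimage.
have E0 := indep_info_T indep [set k | (n <= k)%N] GAB.
by rewrite killing_tail muleC in E0; rewrite setIAC.
Qed.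

Lemma pay_le A n v Z : all_info A -> measurable_fun setT v ->
  (forall y, 0 <= v y)%R -> measurable_fun setT Z -> (forall w, 0 <= Z w) ->
  dominated v Z ->
  pay A n (EFin \o v) <= \int[mu]_(w in A `&` [set w | (n <= T w)%N]) Z w.
Proof.
move=> GA mv v0 mZ Z0 vZ.
have mA : measurable A by exact: info_measurable GA.
have mTn : measurable [set w | (n <= T w)%N].
  rewrite -[X in measurable X]setTI.
  exact: (measurable_funPT T measurableT [set k | (n <= k)%N]).
rewrite pay_killed//; last by split => //; exact/measurable_EFinP.
apply: ge0_le_integral => //.
- exact: measurableI.
- by move=> w _; rewrite lee_fin.
- apply: measurable_funTS; apply/measurable_EFinP.
  by apply: (measurableT_comp (f := v)).
- exact: measurable_funTS.
- by move=> w [_ nT]; exact: vZ.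
Qed.

Let info_tau n : all_info (stop_at tau n) /\ all_info (alive tau n).
Proof.
have st k : all_info (stop_at tau k).
  by apply: (info_widen (filtration_info (c := setT)
    (stopping_stop_at tau_stop))).
split=> //; case: n => [|n]; first by rewrite alive0; exact: g_sigma_algebraT.
by apply: (info_widen (filtration_info (c := setT) (stopping_alive tau_stop))).
Qed.

Let info_sigma n : all_info (stop_at sigma n) /\ all_info (alive sigma n).
Proof.
have al k : all_info (alive sigma k).
  rewrite -(inhomogeneous_timeE X eta q); apply: inhomogeneous_alive => //.
    by move=> j B kn mB; apply: info_X; exact: sigma_process_preimage.
  by move=> j B kn mB; apply: info_eta; exact: sigma_process_preimage.
split=> //; rewrite (_ : stop_at _ _ = alive sigma n `\` alive sigma n.+1).
  by apply: g_sigma_algebraD; exact: al.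
by rewrite aliveS setDD setIidr//; exact: stop_at_alive.
Qed.

Let info_cells n : [/\ all_info (stop_at tau n `&` alive sigma n.+1),
  all_info (alive tau n.+1 `&` stop_at sigma n) &
  all_info (stop_at tau n `&` stop_at sigma n)].
Proof.
by split; apply: infoI; do ?[exact: (info_tau _).1|exact: (info_tau _).2
  |exact: (info_sigma _).1|exact: (info_sigma _).2].
Qed.

Let measurable_cells n : [/\ measurable (stop_at tau n `&` alive sigma n.+1),
  measurable (alive tau n.+1 `&` stop_at sigma n) &
  measurable (stop_at tau n `&` stop_at sigma n)].
Proof.
have [? ? ?] := info_cells n.
by split; apply: (info_measurable (X := X) (xi := xi) (eta := eta));
  eassumption.
Qed.

Let measurable_stops n : measurable (play_stops tau sigma n).
Proof.
by have [? ? ?] := measurable_cells n; apply: measurableU => //;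
  exact: measurableU.
Qed.

Let never_alive t n (w : Omega) : stop_at t n w -> alive t n.+1 w -> False.
Proof. by rewrite aliveS => s [_]. Qed.

Let integral_stops n (F : Omega -> \bar R) : (forall w, 0 <= F w) ->
  measurable_fun (play_stops tau sigma n) F ->
  \int[mu]_(w in play_stops tau sigma n) F w =
  \int[mu]_(w in stop_at tau n `&` alive sigma n.+1) F w +
  \int[mu]_(w in alive tau n.+1 `&` stop_at sigma n) F w +
  \int[mu]_(w in stop_at tau n `&` stop_at sigma n) F w.
Proof.
move=> F0 mF; have [m1 m2 m3] := measurable_cells n.
rewrite /play_stops ge0_integral_setU//; [|exact: measurableU|].
  congr (_ + _); rewrite ge0_integral_setU//.
    by apply: (measurable_funS _ _ mF) => // w ?; left.
  by apply/disj_setPS => w [[s _] [a _]]; exact: never_alive s a.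
apply/disj_setPS => w [[[_ a]|[a _]] [s s']].
  exact: never_alive s' a.
exact: never_alive s a.
Qed.

Let measurable_realized_cells f g h n : measurable_fun setT f ->
  measurable_fun setT g -> measurable_fun setT h ->
  measurable_fun (play_stops tau sigma n) (realized alpha X f g h tau sigma).
Proof.
move=> mf mg mh; have [m1 m2 m3] := measurable_cells n.
have mv v D : measurable_fun setT v ->
    measurable_fun D (fun w => (alpha ^+ n * v (X n w))%R).
  move=> mv; apply: measurable_funTS; apply: measurable_funM => //.
  by apply: (measurableT_comp (f := v)).
apply/measurable_funU; [exact: measurableU|by []|split].
  apply/measurable_funU => //; split.
    apply: eq_measurable_fun (mv f _ mf) => w /set_mem[s a].
    by rewrite (realized_first _ _ _ _ _ s a).
  apply: eq_measurable_fun (mv g _ mg) => w /set_mem[s a].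
  by rewrite (realized_second _ _ _ _ _ s a).
apply: eq_measurable_fun (mv h _ mh) => w /set_mem[s a].
by rewrite (realized_both _ _ _ _ _ s a).
Qed.

Let realized_stops f g h :
  (realized alpha X f g h tau sigma) \_ (\bigcup_n play_stops tau sigma n) =
  realized alpha X f g h tau sigma.
Proof.
apply/funext => w; rewrite patchE; case: ifPn => // /negP wn.
have [|tN sN] := @play_stops_never _ tau sigma w.
  by move=> ?; apply: wn; rewrite inE.
by rewrite realized_never.
Qed.

Lemma measurable_realized f g h : measurable_fun setT f ->
  measurable_fun setT g -> measurable_fun setT h ->
  measurable_fun setT (realized alpha X f g h tau sigma).
Proof.
move=> mf mg mh; rewrite -realized_stops.
apply/(measurable_restrictT _ _).1; first exact: bigcupT_measurable.
apply/measurable_fun_bigcup => // n; exact: measurable_realized_cells.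
Qed.

Lemma integral_realized f g h : measurable_fun setT f ->
  measurable_fun setT g -> measurable_fun setT h ->
  (forall y, 0 <= f y)%R -> (forall y, 0 <= g y)%R -> (forall y, 0 <= h y)%R ->
  \int[mu]_w (realized alpha X f g h tau sigma w)%:E =
  \sum_(n <oo) collected n (EFin \o f) (EFin \o g) (EFin \o h).
Proof.
move=> mf mg mh f0 g0 h0; pose F w := (realized alpha X f g h tau sigma w)%:E.
have F0 w : 0 <= F w by rewrite lee_fin; exact: realized_ge0.
have mF D : measurable_fun D F.
  apply: measurable_funTS; apply/measurable_EFinP; exact: measurable_realized.
transitivity (\int[mu]_(w in \bigcup_n play_stops tau sigma n) F w).
  rewrite [RHS]integral_mkcond; apply: eq_integral => w _.
  rewrite -/(F w) patchE; case: ifPn => // /negP wn.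
  have [|tN sN] := @play_stops_never _ tau sigma w.
    by move=> ?; apply: wn; rewrite inE.
  by rewrite /F realized_never.
rewrite ge0_integral_bigcup//; last exact: trivIset_play_stops.
apply: eq_eseriesr => n _; rewrite integral_stops// /collected pay.unlock.
congr (_ + _ + _); apply: eq_integral => w /set_mem[s a]; rewrite /F -EFinM.
- by rewrite (realized_first _ _ _ _ _ s a).
- by rewrite (realized_second _ _ _ _ _ s a).
- by rewrite (realized_both _ _ _ _ _ s a).
Qed.

(** The cells in which the play ends are disjoint, so that summing [pay_le] over
    all of them uses the integral of [Z] only once. *)
Lemma collected_lty f g h Z : measurable_fun setT f ->
  measurable_fun setT g -> measurable_fun setT h ->
  (forall y, 0 <= f y)%R -> (forall y, 0 <= g y)%R -> (forall y, 0 <= h y)%R ->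
  measurable_fun setT Z -> (forall w, 0 <= Z w) -> \int[mu]_w Z w < +oo ->
  dominated f Z -> dominated g Z -> dominated h Z ->
  \sum_(n <oo) collected n (EFin \o f) (EFin \o g) (EFin \o h) < +oo.
Proof.
move=> mf mg mh f0 g0 h0 mZ Z0 Zoo fZ gZ hZ.
apply: le_lt_trans Zoo.
apply: (@le_trans _ _ (\int[mu]_(w in \bigcup_n play_stops tau sigma n) Z w)).
  rewrite ge0_integral_bigcup//; last 2 first.
    exact: measurable_funTS.
    exact: trivIset_play_stops.
  apply: lee_nneseries => [n _ _|n _].
    by apply: (collected_ge0 _ model); exact: payoff_EFin.
  rewrite integral_stops//; last exact: measurable_funTS.
  have [i1 i2 i3] := info_cells n.
  have le1 v A : all_info A -> measurable_fun setT v ->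
      (forall y, 0 <= v y)%R -> dominated v Z ->
      pay A n (EFin \o v) <= \int[mu]_(w in A) Z w.
    move=> iA mv v0 vZ; apply: le_trans (pay_le _ iA mv v0 mZ Z0 vZ) _.
    have mA := info_measurable iA.
    apply: ge0_subset_integral => //; last exact: measurable_funTS.
    apply: measurableI => //; rewrite -[X in measurable X]setTI.
    exact: (measurable_funPT T measurableT [set k | (n <= k)%N]).
  by rewrite /collected !leeD// le1.
apply: ge0_subset_integral => //; exact: bigcupT_measurable.
Qed.

(** [realized] is linear in [(f, g, h)]. *)
Lemma reward_split f g h Z : measurable_fun setT f ->
  measurable_fun setT g -> measurable_fun setT h ->
  measurable_fun setT Z -> (forall w, 0 <= Z w) -> \int[mu]_w Z w < +oo ->
  dominated (fun y => `|f y|)%R Z -> dominated (fun y => `|g y|)%R Z ->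
  dominated (fun y => `|h y|)%R Z ->
  let Jp := \sum_(n <oo) collected n
    (EFin \o f^\+%R) (EFin \o g^\+%R) (EFin \o h^\+%R) in
  let Jm := \sum_(n <oo) collected n
    (EFin \o f^\-%R) (EFin \o g^\-%R) (EFin \o h^\-%R) in
  [/\ 0 <= Jp < +oo, 0 <= Jm < +oo &
    reward mu alpha X f g h tau sigma = Jp - Jm].
Proof.
move=> mf mg mh mZ Z0 Zoo fZ gZ hZ Jp Jm.
have posZ v : dominated (fun y => `|v y|)%R Z -> dominated v^\+%R Z.
  move=> vZ n w nT; apply: le_trans (vZ n w nT).
  by rewrite lee_fin /funrpos ge_max ler_norm normr_ge0.
have negZ v : dominated (fun y => `|v y|)%R Z -> dominated v^\-%R Z.
  move=> vZ n w nT; apply: le_trans (vZ n w nT).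
  by rewrite lee_fin /funrneg ge_max -normrN ler_norm normr_ge0.
have mpos v : measurable_fun setT v -> measurable_fun setT v^\+%R.
  exact: measurable_funrpos.
have mneg v : measurable_fun setT v -> measurable_fun setT v^\-%R.
  exact: measurable_funrneg.
have Jpoo : 0 <= Jp < +oo.
  apply/andP; split.
    by apply: nneseries_ge0 => n _ _; apply: (collected_ge0 _ model);
      apply: payoff_EFin => //; exact: mpos.
  apply: (@collected_lty _ _ _ Z);
    by [exact: mpos|exact: funrpos_ge0|exact: posZ|].
have Jmoo : 0 <= Jm < +oo.
  apply/andP; split.
    by apply: nneseries_ge0 => n _ _; apply: (collected_ge0 _ model);
      apply: payoff_EFin => //; exact: mneg.
  apply: (@collected_lty _ _ _ Z);
    by [exact: mneg|exact: funrneg_ge0|exact: negZ|].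
split => //; rewrite /Jp /Jm -!integral_realized//;
  do ?[exact: mpos|exact: mneg].
rewrite -integralB_EFin//; last 2 first.
- apply/integrableP; split.
    by apply/measurable_EFinP; apply: measurable_realized; exact: mpos.
  under eq_integral => w _ do rewrite gee0_abs ?lee_fin ?realized_ge0//.
  by rewrite integral_realized//; [case/andP: Jpoo|exact: mpos..].
- apply/integrableP; split.
    by apply/measurable_EFinP; apply: measurable_realized; exact: mneg.
  under eq_integral => w _ do rewrite gee0_abs ?lee_fin ?realized_ge0//.
  by rewrite integral_realized//; [case/andP: Jmoo|exact: mneg..].
rewrite /reward unlock; apply: eq_integral => w _.
rewrite -EFinB -realizedB; congr EFin.
have posneg v : v = (fun y => v^\+ y - v^\- y)%R by rewrite -[LHS]funrposBneg.
by rewrite -(posneg f) -(posneg g) -(posneg h).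
Qed.


End reward_series.

(** * Telescoping and vanishing tails *)

Section telescoping.
Context (R : realType).
Implicit Types (rp rm bp bm : nat -> \bar R).

(** Think of [rp - rm] as a reward per period and of [bp - bm] as the value of
    the remaining play; the step hypothesis says that this value loses at least
    the reward of each period. Keeping the parts on the side where they are
    positive avoids differences of infinite sums. *)
Lemma telescope_le rp rm bp bm :
  (forall n, 0 <= rp n < +oo) -> (forall n, 0 <= rm n < +oo) ->
  (forall n, 0 <= bp n < +oo) -> (forall n, 0 <= bm n < +oo) ->
  (forall n, rp n + (bp n.+1 + bm n) <= rm n + (bm n.+1 + bp n)) ->
  bm @ \oo --> 0 ->
  \sum_(n <oo) rp n + bm 0%N <= \sum_(n <oo) rm n + bp 0%N.
Proof.
move=> rpb rmb bpb bmb step bm0.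
have fin (x : \bar R) : 0 <= x < +oo -> x \is a fin_num.
  by move=> /andP[x0 xoo]; rewrite ge0_fin_numE.
have part N : \sum_(0 <= k < N) rp k + (bp N + bm 0%N) <=
    \sum_(0 <= k < N) rm k + (bm N + bp 0%N).
  elim: N => [|N IHN]; first by rewrite !big_nil !add0e addeC.
  rewrite !big_nat_recr//=.
  have sfin (r : nat -> \bar R) : (forall n, 0 <= r n < +oo) ->
      \sum_(0 <= k < N) r k \is a fin_num.
    move=> rb; rewrite sum_fin_num; apply/allP => _ /mapP[k _ ->].
    exact: fin.
  move: IHN (step N).
  move: (sfin _ rpb) (sfin _ rmb) (fin _ (rpb N)) (fin _ (rmb N))
    (fin _ (bpb N)) (fin _ (bmb N)) (fin _ (bpb N.+1)) (fin _ (bmb N.+1))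
    (fin _ (bpb 0%N)) (fin _ (bmb 0%N)).
  do 10![case: (X in X \is a fin_num -> _) => // ? _].
  rewrite -!EFinD !lee_fin; lra.
have {}part N : \sum_(0 <= k < N) rp k + bm 0%N <=
    (\sum_(n <oo) rm n + bp 0%N) + bm N.
  apply: le_trans (_ : _ <= \sum_(0 <= k < N) rm k + (bm N + bp 0%N)) _.
    apply: le_trans (part N); apply: leeD => //; apply: leeDr.
    by case/andP: (bpb N).
  rewrite (addeC (bm N)) addeA !leeD//; apply: nneseries_lim_ge => k _ _.
  by case/andP: (rmb k).
have cvl : \sum_(0 <= k < N) rp k + bm 0%N @[N --> \oo] -->
    \sum_(n <oo) rp n + bm 0%N.
  apply: cvgeD; last exact: cvg_cst.
    by rewrite fin_num_adde_defl// fin.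
  by apply: is_cvg_nneseries => k _ _; case/andP: (rpb k).
have cvr : (\sum_(n <oo) rm n + bp 0%N) + bm N @[N --> \oo] -->
    \sum_(n <oo) rm n + bp 0%N.
  rewrite -[X in _ --> X]adde0; apply: cvgeD; [|exact: cvg_cst|exact: bm0].
  by rewrite fin_num_adde_defl.
apply: lee_cvg_to cvl cvr _.
by apply: nearW => N; exact: part.
Qed.

End telescoping.

Section tail.
Context d (Omega : measurableType d) (R : realType)
  (mu : {measure set Omega -> \bar R}) (T : {mfun Omega >-> nat}).

Lemma cvg_integral_tail (Z : Omega -> \bar R) : measurable_fun setT Z ->
  (forall w, 0 <= Z w) -> \int[mu]_w Z w < +oo ->
  \int[mu]_(w in [set w | (n <= T w)%N]) Z w @[n --> \oo] --> 0.
Proof.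
move=> mZ Z0 Zoo; pose F n := [set w | (n <= T w)%N].
have mF n : measurable (F n).
  rewrite -[X in measurable X]setTI.
  exact: (measurable_funPT T measurableT [set k | (n <= k)%N]).
have F0 : \bigcap_n F n = set0.
  apply/seteqP; split => // w /(_ (T w).+1 Logic.I) /=.
  by rewrite /F /= ltnn.
have := @nonincreasing_cvg_mu _ _ _ (density mu mZ Z0) F.
rewrite F0 measure0; apply => //.
  rewrite (_ : F 0%N = setT)//.
  by apply/seteqP; split.
by move=> m n mn; apply/subsetPset => w /=; exact: leq_trans.
Qed.

End tail.

(** * Comparing two payoff systems along one play *)

Section parts.
Context (R : realType).

Lemma posnegE (E : Type) (v : E -> R) y : (v^\+ y - v^\- y)%R = v y.
Proof. by have := funrposBneg v => /(congr1 (fun k => k y)). Qed.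

Lemma ge0_lty_fin_num (a : \bar R) : 0 <= a < +oo -> a \is a fin_num.
Proof. by move=> /andP[a0 aoo]; rewrite ge0_fin_numE. Qed.

Lemma lee_sub_parts (a b : \bar R) (r s : R) :
  0 <= a < +oo -> 0 <= b < +oo -> a + s%:E <= b + r%:E -> a - b <= (r - s)%:E.
Proof.
move=> /ge0_lty_fin_num af /ge0_lty_fin_num bf.
case: a af => // a _; case: b bf => // b _.
rewrite -EFinB -!EFinD !lee_fin; lra.
Qed.

Lemma lee_sub_parts_opp (a b : \bar R) (r s : R) :
  0 <= a < +oo -> 0 <= b < +oo -> b + r%:E <= a + s%:E -> (r - s)%:E <= a - b.
Proof.
move=> /ge0_lty_fin_num af /ge0_lty_fin_num bf.
case: a af => // a _; case: b bf => // b _.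
rewrite -EFinB -!EFinD !lee_fin; lra.
Qed.

Lemma mixture_of_max (v c s r : R) : (0 <= r <= 1)%R -> v = Num.max c s ->
  ((0 < r)%R -> (c <= s)%R) -> ((r < 1)%R -> (s <= c)%R) ->
  v = (r * s + (1 - r) * c)%R.
Proof.
move=> /andP[r0 r1] -> cs sc.
have [r00|rn0] := eqVneq r 0%R.
  have r1' : (r < 1)%R by rewrite r00 ltr01.
  by rewrite (max_idPl (sc r1')) r00; ring.
have {}r0 : (0 < r)%R by rewrite lt_neqAle eq_sym rn0.
have [r11|rn1] := eqVneq r 1%R; first by rewrite (max_idPr (cs r0)) r11; ring.
have {}r1 : (r < 1)%R by rewrite lt_neqAle rn1.
have -> : s = c by apply/eqP; rewrite eq_le sc// cs.
by rewrite maxxx; ring.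
Qed.

End parts.

(** From here on the starting point varies, since a value function evaluated at
    [X n] refers to plays started elsewhere. *)
Section player_family.
Context d d' (E : measurableType d) (Omega : measurableType d') (R : realType).
Variables (P : E -> probability Omega R) (X : nat -> {mfun Omega >-> E})
  (xi eta : nat -> {mfun Omega >-> R}) (T : {mfun Omega >-> nat})
  (Pi : R.-pker E ~> E) (alpha : R).
Hypotheses (model : forall x, randomized_model (P x) X xi eta T Pi alpha)
  (start : forall x B, measurable B -> distribution (P x) (X 0%N) B = \d_x B).
Variables (f g h p q : E -> R) (Z : Omega -> \bar R).
Hypotheses (mf : measurable_fun setT f) (mg : measurable_fun setT g)
  (mh : measurable_fun setT h) (mp : measurable_fun setT p)
  (mq : measurable_fun setT q)
  (p01 : forall y, (0 <= p y <= 1)%R) (q01 : forall y, (0 <= q y <= 1)%R).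
Hypotheses (mZ : measurable_fun setT Z) (Z0 : forall w, 0 <= Z w)
  (Zoo : forall x, \int[P x]_w Z w < +oo)
  (fZ : dominated X T (fun y => `|f y|)%R Z)
  (gZ : dominated X T (fun y => `|g y|)%R Z)
  (hZ : dominated X T (fun y => `|h y|)%R Z).
Implicit Types (x y : E) (n : nat) (u : E -> \bar R).

Local Notation sigma := (markovian_time X eta q).

Lemma integral_start x u : payoff u -> \int[P x]_w u (X 0%N w) = u x.
Proof.
move=> [mu u0]; rewrite -(integral_diracT x mu).
transitivity (\int[distribution (P x) (X 0%N)]_y u y).
  by rewrite ge0_integral_distribution.
apply: eq_measure_integral => B mB _; exact: start.
Qed.

Lemma pay_start x u : payoff u -> pay (P x) X alpha setT 0 u = u x.
Proof.
move=> gu; rewrite pay.unlock -(integral_start x gu).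
by apply: eq_integral => w _; rewrite expr0 mul1e.
Qed.

(** [Pi y] is the law of [X 1] under [P y], and [alpha] times the integral is
    the killed expectation at time [1], bounded by that of [Z]. *)
Lemma kernel_lty y (v : E -> R) : measurable_fun setT v ->
  (forall z, 0 <= v z)%R -> dominated X T v Z ->
  \int[Pi y]_z (v z)%:E < +oo.
Proof.
move=> mv v0 vZ; have gv : payoff (EFin \o v) by exact: payoff_EFin.
have /andP[a0 _] := model_discount (model y).
have all a b c : info X xi eta a b c setT by exact: g_sigma_algebraT.
have : pay (P y) X alpha setT 1 (EFin \o v) < +oo.
  apply: le_lt_trans (Zoo y).
  apply: le_trans (pay_le (model y) 1 (all _ _ _) mv v0 mZ Z0 vZ) _.
  apply: ge0_subset_integral => //.
  apply: measurableI => //; rewrite -[X in measurable X]setTI.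
  exact: (measurable_funPT T measurableT [set k | (1 <= k)%N]).
rewrite (pay_transition (model y) (all _ _ _) gv) pay_start; last first.
  apply: payoffM; first by apply: payoff_cst; exact: ltW.
  exact: payoff_kernel.
have : 0 <= \int[Pi y]_z (EFin \o v) z.
  by apply: integral_ge0 => z _; rewrite lee_fin.
rewrite -/(EFin \o v).
case: (\int[Pi y]_z _) => [r _ _| _ |//]; first exact: ltry.
by rewrite mulry gtr0_sg// mul1e ltxx.
Qed.

(** The class of payoffs for which every series and remainder below is finite.
    *)
Definition tame (v : E -> R) :=
  [/\ measurable_fun setT v, (forall z, 0 <= v z)%R & dominated X T v Z].

Lemma tame_payoff v : tame v -> payoff (EFin \o v).
Proof. by case=> mv v0 _; exact: payoff_EFin. Qed.

Lemma tame_pos (v : E -> R) : measurable_fun setT v ->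
  dominated X T (fun y => `|v y|)%R Z -> tame v^\+%R.
Proof.
move=> mv vZ; split => //; first exact: measurable_funrpos.
move=> n w nT; apply: le_trans (vZ n w nT).
by rewrite lee_fin /funrpos ge_max ler_norm normr_ge0.
Qed.

Lemma tame_neg (v : E -> R) : measurable_fun setT v ->
  dominated X T (fun y => `|v y|)%R Z -> tame v^\-%R.
Proof.
move=> mv vZ; split => //; first exact: measurable_funrneg.
move=> n w nT; apply: le_trans (vZ n w nT).
by rewrite lee_fin /funrneg ge_max -normrN ler_norm normr_ge0.
Qed.

Section fixed_start.
Variables (x : E) (tau : Omega -> option nat).
Hypothesis tau_stop : stopping_times X xi tau.
Local Notation collected := (collected (P x) X eta alpha q tau).
Local Notation both_alive := (both_alive X eta q tau).
Local Notation pay := (pay (P x) X alpha).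

Let pay_tail n (v : E -> R) : tame v -> pay (both_alive n) n (EFin \o v) <=
  \int[P x]_(w in [set w | (n <= T w)%N]) Z w.
Proof.
move=> [mv v0 vZ].
have all : info X xi eta setT setT setT (both_alive n).
  exact: info_both_alive.
have mTn : measurable [set w | (n <= T w)%N].
  rewrite -[X in measurable X]setTI.
  exact: (measurable_funPT T measurableT [set k | (n <= k)%N]).
apply: le_trans (pay_le (model x) n all mv v0 mZ Z0 vZ) _.
apply: ge0_subset_integral => //; last exact: measurable_funTS.
by apply: measurableI => //; exact: info_measurable all.
Qed.

Let pay_fin n (v : E -> R) : tame v ->
  0 <= pay (both_alive n) n (EFin \o v) < +oo.
Proof.
move=> tv; apply/andP; split.
  by apply: (pay_ge0 (model x)); exact: tame_payoff.
apply: le_lt_trans (pay_tail n tv) _; apply: le_lt_trans (Zoo x).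
apply: ge0_subset_integral => //; rewrite -[X in measurable X]setTI.
exact: (measurable_funPT T measurableT [set k | (n <= k)%N]).
Qed.

Let pay_cvg0 (v : E -> R) : tame v ->
  pay (both_alive n) n (EFin \o v) @[n --> \oo] --> 0.
Proof.
move=> tv; have c0 := cvg_integral_tail T mZ Z0 (Zoo x).
apply: squeeze_cvge (cvg_cst 0) c0; apply: nearW => n.
by rewrite pay_tail// andbT; case/andP: (pay_fin n tv).
Qed.

Let collected_fin n (a b c : E -> R) : tame a -> tame b -> tame c ->
  0 <= collected n (EFin \o a) (EFin \o b) (EFin \o c) < +oo.
Proof.
move=> ta tb tc; pose r k := collected k (EFin \o a) (EFin \o b) (EFin \o c).
have r0 k : 0 <= r k.
  by apply: (collected_ge0 _ (model x)); exact: tame_payoff.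
apply/andP; split; first exact: r0.
have [ma a0 aZ] := ta; have [mb b0 bZ] := tb; have [mc c0 cZ] := tc.
apply: le_lt_trans
  (collected_lty (model x) mq tau_stop ma mb mc a0 b0 c0 mZ Z0 (Zoo x)
    aZ bZ cZ).
apply: le_trans (nneseries_lim_ge n.+1 _); last by move=> k _ _; exact: r0.
rewrite big_nat_recr//=; apply: leeDr.
by apply: sume_ge0 => k _; exact: r0.
Qed.

(** The remainders after [n] periods are bounded by the integral of [Z] over
    [T >= n], which tends to [0]. *)
Lemma compare_plays (fp gp hp up fm gm hm um : E -> R) :
  tame fp -> tame gp -> tame hp -> tame up ->
  tame fm -> tame gm -> tame hm -> tame um ->
  (forall n,
    collected n (EFin \o fp) (EFin \o gp) (EFin \o hp) +
      (pay (both_alive n.+1) n.+1 (EFin \o up) +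
       pay (both_alive n) n (EFin \o um)) <=
    collected n (EFin \o fm) (EFin \o gm) (EFin \o hm) +
      (pay (both_alive n.+1) n.+1 (EFin \o um) +
       pay (both_alive n) n (EFin \o up))) ->
  \sum_(n <oo) collected n (EFin \o fp) (EFin \o gp) (EFin \o hp) +
    (um x)%:E <=
  \sum_(n <oo) collected n (EFin \o fm) (EFin \o gm) (EFin \o hm) +
    (up x)%:E.
Proof.
move=> tfp tgp thp tup tfm tgm thm tum step.
have start0 v : tame v -> (v x)%:E = pay (both_alive 0) 0 (EFin \o v).
  move=> tv; rewrite /both_alive !alive0 setTI pay_start//.
  exact: tame_payoff.
rewrite (start0 um)// (start0 up)//.
apply: (telescope_le (bp := fun n => pay (both_alive n) n (EFin \o up))
  (bm := fun n => pay (both_alive n) n (EFin \o um))) => //.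
- by move=> n; exact: collected_fin.
- by move=> n; exact: collected_fin.
- by move=> n; exact: pay_fin.
- by move=> n; exact: pay_fin.
- exact: pay_cvg0.
Qed.

(** The two inequalities are pointwise in the state; [one_step] weighs them by
    the probabilities of reaching that state and of stopping in it. *)
Lemma compare_times (fp gp hp up fm gm hm um : E -> R) :
  tame fp -> tame gp -> tame hp -> tame up ->
  tame fm -> tame gm -> tame hm -> tame um ->
  (forall y, stop_value q (EFin \o fp) (EFin \o hp) y + (um y)%:E <=
    stop_value q (EFin \o fm) (EFin \o hm) y + (up y)%:E) ->
  (forall y, cont_value Pi alpha q (EFin \o gp) (EFin \o up) y + (um y)%:E <=
    cont_value Pi alpha q (EFin \o gm) (EFin \o um) y + (up y)%:E) ->
  \sum_(n <oo) collected n (EFin \o fp) (EFin \o gp) (EFin \o hp) +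
    (um x)%:E <=
  \sum_(n <oo) collected n (EFin \o fm) (EFin \o gm) (EFin \o hm) +
    (up x)%:E.
Proof.
move=> tfp tgp thp tup tfm tgm thm tum leS leC.
apply: compare_plays => // n.
have [g1 g2 g3 g4] :=
  And4 (tame_payoff tfp) (tame_payoff tgp) (tame_payoff thp) (tame_payoff tup).
have [g5 g6 g7 g8] :=
  And4 (tame_payoff tfm) (tame_payoff tgm) (tame_payoff thm) (tame_payoff tum).
have gSp := payoff_stop_value mq q01 g1 g3.
have gSm := payoff_stop_value mq q01 g5 g7.
have gCp := payoff_cont_value (model x) mq q01 g2 g4.
have gCm := payoff_cont_value (model x) mq q01 g6 g8.
pose A1 := stop_at tau n `&` alive sigma n.
pose A2 := alive tau n.+1 `&` alive sigma n.
have iS : info X xi eta setT setT [set k | (k < n)%N] A1 by exact: info_stop.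
have iG : info X xi eta setT setT [set k | (k < n)%N] A2 by exact: info_go.
have mA1 : measurable A1 by exact: info_measurable iS.
have mA2 : measurable A2 by exact: info_measurable iG.
have split_alive v : payoff v ->
    pay (both_alive n) n v = pay A1 n v + pay A2 n v.
  move=> gv; rewrite -(pay_setU (model x))//.
    by rewrite -setIUl -alive_split.
  apply/seteqP; split => // w [[s _] [a _]]; move: a; rewrite aliveS => -[_].
  exact.
rewrite !addeA !(one_step (model x) mq q01 tau_stop)// !split_alive//.
rewrite -!/A1 -!/A2 addeACA [leRHS]addeACA -!(payD (model x))//.
by apply: leeD; apply: (le_pay (model x)) => //; exact: payoffD.
Qed.

End fixed_start.

(** Against a Markovian own time a single inequality, for the mixed action, is
    enough. It is used in both directions, which yields equalities. *)
Lemma compare_markovian x (fp gp hp up fm gm hm um : E -> R) :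
  let collected := collected (P x) X eta alpha q (markovian_time X xi p) in
  tame fp -> tame gp -> tame hp -> tame up ->
  tame fm -> tame gm -> tame hm -> tame um ->
  (forall y, bellman Pi alpha q p
      (EFin \o fp) (EFin \o gp) (EFin \o hp) (EFin \o up) y + (um y)%:E <=
    bellman Pi alpha q p
      (EFin \o fm) (EFin \o gm) (EFin \o hm) (EFin \o um) y + (up y)%:E) ->
  \sum_(n <oo) collected n (EFin \o fp) (EFin \o gp) (EFin \o hp) +
    (um x)%:E <=
  \sum_(n <oo) collected n (EFin \o fm) (EFin \o gm) (EFin \o hm) +
    (up x)%:E.
Proof.
move=> collected tfp tgp thp tup tfm tgm thm tum leB.
have st : stopping_times X xi (inhomogeneous_time X xi (fun=> p)).
  exact: inhomogeneous_stopping.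
apply: (compare_plays st) => // n.
have [g1 g2 g3 g4] :=
  And4 (tame_payoff tfp) (tame_payoff tgp) (tame_payoff thp) (tame_payoff tup).
have [g5 g6 g7 g8] :=
  And4 (tame_payoff tfm) (tame_payoff tgm) (tame_payoff thm) (tame_payoff tum).
have mp' (k : nat) : measurable_fun setT ((fun=> p) k) by [].
have p01' (k : nat) y : (0 <= (fun=> p) k y <= 1)%R by exact: p01.
rewrite !addeA !(one_step_markovian (model x) mq q01 mp' p01')//.
have mA := info_measurable (info_both_alive mq st n).
have gBp := payoff_bellman (model x) mq q01 mp' p01' n g1 g2 g3 g4.
have gBm := payoff_bellman (model x) mq q01 mp' p01' n g5 g6 g7 g8.
rewrite -!(payD (model x))//.
by apply: (le_pay (model x)) => //; exact: payoffD.
Qed.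

(** * The verification argument *)

Variable V : E -> R.
Hypotheses (mV : measurable_fun setT V).

Lemma cont_valueE (a b : E -> R) y : \int[Pi y]_z (b z)%:E \is a fin_num ->
  cont_value Pi alpha q (EFin \o a) (EFin \o b) y =
  ((1 - q y) * (alpha * fine (\int[Pi y]_z (b z)%:E)) + q y * a y)%:E.
Proof. by move=> bfin; rewrite /cont_value -[in LHS](fineK bfin). Qed.

Lemma stop_valueE (a b : E -> R) y :
  stop_value q (EFin \o a) (EFin \o b) y =
  ((1 - q y) * a y + q y * b y)%:E.
Proof. by []. Qed.

Lemma kernel_opE y :
  \int[Pi y]_z (V^\+%R z)%:E \is a fin_num ->
  \int[Pi y]_z (V^\-%R z)%:E \is a fin_num ->
  kernel_op Pi V y = (fine (\int[Pi y]_z (V^\+%R z)%:E) -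
                      fine (\int[Pi y]_z (V^\-%R z)%:E))%:E.
Proof.
move=> pfin nfin; rewrite EFinB !fineK// /kernel_op integralE.
by rewrite funerpos funerneg.
Qed.

Section verification.
Hypotheses (VZ : dominated X T (fun y => `|V y|)%R Z).

Let tVp := tame_pos mV VZ.
Let tVm := tame_neg mV VZ.

Let fin_tame y v : tame v -> \int[Pi y]_z (v z)%:E \is a fin_num.
Proof.
move=> [mv v0 vZ]; rewrite ge0_fin_numE; first exact: kernel_lty.
by apply: integral_ge0 => z _; rewrite lee_fin.
Qed.

Let continuationE y : continuation Pi alpha q V g y =
  ((1 - q y) * (alpha * (fine (\int[Pi y]_z (V^\+%R z)%:E) -
                         fine (\int[Pi y]_z (V^\-%R z)%:E))) + q y * g y)%:E.
Proof. by rewrite /continuation kernel_opE ?fin_tame. Qed.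

(** If [V] is at least the value of either action, then [V] is a
    supermartingale along every play: [compare_times] applies to the positive
    and negative parts of [f], [g], [h] and [V], where the sign split turns
    each inequality into one between nonnegative terms. *)
Lemma verification_le x tau : stopping_times X xi tau ->
  (forall y, continuation Pi alpha q V g y <= (V y)%:E) ->
  (forall y, stopping q f h y <= (V y)%:E) ->
  reward (P x) alpha X f g h tau sigma <= (V x)%:E.
Proof.
move=> st CV SV.
have [Jpb Jmb ->] :=
  reward_split (model x) mq st mf mg mh mZ Z0 (Zoo x) fZ gZ hZ.
rewrite -(posnegE V x); apply: lee_sub_parts => //.
apply: compare_times => //; do ?[exact: tame_pos|exact: tame_neg] => y.
  have := SV y; rewrite /stopping !stop_valueE -!EFinD !lee_fin.
  rewrite -(posnegE f y) -(posnegE h y) -(posnegE V y); lra.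
have := CV y; rewrite !cont_valueE ?fin_tame// continuationE -!EFinD !lee_fin.
rewrite -(posnegE g y) -(posnegE V y); lra.
Qed.

(** Actions of positive probability attain the maximum, so [V] equals the value
    of the mixed action and [compare_markovian] applies both ways. *)
Lemma verification_eq x :
  (forall y,
    [/\ (V y)%:E = maxe (continuation Pi alpha q V g y) (stopping q f h y),
      ((0 < p y)%R -> continuation Pi alpha q V g y <= stopping q f h y) &
      ((p y < 1)%R -> stopping q f h y <= continuation Pi alpha q V g y)]) ->
  reward (P x) alpha X f g h (markovian_time X xi p) sigma = (V x)%:E.
Proof.
move=> system.
have BV y : (p y)%:E * stopping q f h y +
    (1 - p y)%:E * continuation Pi alpha q V g y = (V y)%:E.
  have := system y; rewrite continuationE /stopping -EFin_max !lee_fin.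
  move=> [[Vmax] cs sc]; rewrite -!EFinM -EFinD; congr EFin.
  exact/esym/(mixture_of_max (p01 y) Vmax cs sc).
have st : stopping_times X xi (inhomogeneous_time X xi (fun=> p)).
  exact: inhomogeneous_stopping.
have [Jpb Jmb ->] :=
  reward_split (model x) mq st mf mg mh mZ Z0 (Zoo x) fZ gZ hZ.
have eqB y : bellman Pi alpha q p (EFin \o f^\+%R) (EFin \o g^\+%R)
      (EFin \o h^\+%R) (EFin \o V^\+%R) y + (V^\-%R y)%:E =
    bellman Pi alpha q p (EFin \o f^\-%R) (EFin \o g^\-%R)
      (EFin \o h^\-%R) (EFin \o V^\-%R) y + (V^\+%R y)%:E.
  have := BV y; rewrite /bellman !cont_valueE ?fin_tame// continuationE.
  rewrite /stopping !stop_valueE -!EFinM -!EFinD.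
  rewrite -(posnegE f y) -(posnegE g y) -(posnegE h y) -(posnegE V y).
  by move=> [E1]; congr EFin; lra.
rewrite -(posnegE V x); apply/eqP; rewrite eq_le; apply/andP; split.
  apply: lee_sub_parts => //.
  apply: compare_markovian => //; do ?[exact: tame_pos|exact: tame_neg] => y.
  by rewrite eqB.
apply: lee_sub_parts_opp => //.
apply: compare_markovian => //; do ?[exact: tame_pos|exact: tame_neg] => y.
by rewrite eqB.
Qed.

End verification.

(** * One-shot deviations and value iteration *)

Section one_shot_deviation.

Definition first_step (r : E -> R) (n : nat) : E -> R :=
  if n is 0%N then r else p.

Let pconst (k : nat) : E -> R := p.

(** Peeling off the first period instead of the last one. *)
Lemma value_iterationSl (pn : nat -> E -> R) (a b c : E -> \bar R) n u :
  value_iteration Pi alpha q pn a b c n.+1 u =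
  bellman Pi alpha q (pn 0%N) a b c
    (value_iteration Pi alpha q (fun k => pn k.+1) a b c n u).
Proof. by elim: n u => //= n IHn u; rewrite -IHn. Qed.

Section play_values.
Variables (a b c : E -> \bar R).
Hypotheses (ga : payoff a) (gb : payoff b) (gc : payoff c).

Definition play_value (r : E -> R) x : \bar R :=
  \sum_(n <oo) collected (P x) X eta alpha q
    (inhomogeneous_time X xi (first_step r)) n a b c.

Let W n : E -> \bar R :=
  value_iteration Pi alpha q pconst a b c n (fun=> 0).

Let payoff0 : payoff (fun _ : E => 0 : \bar R).
Proof. by split. Qed.

Lemma payoff_value_iteration (pn : nat -> E -> R) n u :
  (forall k, measurable_fun setT (pn k)) ->
  (forall k y, (0 <= pn k y <= 1)%R) -> payoff u ->
  payoff (value_iteration Pi alpha q pn a b c n u).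
Proof.
move=> mpn pn01; elim: n u => //= n IHn u gu; apply: IHn.
exact: (payoff_bellman (model point) mq q01 mpn pn01).
Qed.

Let payoffW n : payoff (W n).
Proof. by apply: payoff_value_iteration. Qed.

Section deviation.
Variable r : E -> R.
Hypotheses (mr : measurable_fun setT r) (r01 : forall y, (0 <= r y <= 1)%R).

Let mfs k : measurable_fun setT (first_step r k).
Proof. by case: k. Qed.

Let fs01 k y : (0 <= first_step r k y <= 1)%R.
Proof. by case: k. Qed.

(** With terminal payoff [0], value iteration computes the reward of the first
    periods; only the outermost operator sees the deviation. *)
Lemma partial_play x n :
  \sum_(0 <= k < n.+1) collected (P x) X eta alpha q
    (inhomogeneous_time X xi (first_step r)) k a b c =
  bellman Pi alpha q r a b c (W n) x.
Proof.
rewrite big_mkord.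
have := sum_collected (model x) mq q01 mfs fs01 n.+1 ga gb gc payoff0.
rewrite (_ : pay _ _ _ _ _ _ = 0) ?adde0 => [->|].
  rewrite value_iterationSl integral_start//.
  exact: (payoff_bellman (model x) mq q01 mfs fs01 0 ga gb gc (payoffW n)).
by rewrite pay.unlock integral0_eq// => w _; rewrite mule0.
Qed.

End deviation.

Let fsp : first_step p = pconst.
Proof. by apply/funext => -[|k]. Qed.

Lemma W_sum n x : W n x = \sum_(0 <= k < n) collected (P x) X eta alpha q
    (inhomogeneous_time X xi (first_step p)) k a b c.
Proof.
case: n => [|n]; first by rewrite big_nil.
by rewrite (partial_play mp p01) /W value_iterationSl.
Qed.

Let collected_pos r x n : 0 <= collected (P x) X eta alpha q
    (inhomogeneous_time X xi (first_step r)) n a b c.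
Proof. exact: (collected_ge0 _ (model x)). Qed.

Let cvgW x : W n x @[n --> \oo] --> play_value p x.
Proof.
under eq_cvg do rewrite W_sum.
by apply: is_cvg_nneseries => n _ _.
Qed.

Lemma payoff_play_value : payoff (play_value p).
Proof.
split; last by move=> y; apply: nneseries_ge0 => n _ _.
apply: (emeasurable_fun_cvg (fun n => W n)).
  by move=> n; exact: (payoffW n).1.
by move=> x _; exact: cvgW.
Qed.

Let cvg_kernelW x :
  \int[Pi x]_y W n y @[n --> \oo] --> \int[Pi x]_y play_value p y.
Proof.
rewrite (eq_integral (fun y => limn (W ^~ y))); last first.
  by move=> y _; apply/esym/cvg_lim => //; exact: cvgW.
apply: cvg_monotone_convergence => //.
- by move=> n; exact: (payoffW n).1.
- by move=> n y _; exact: (payoffW n).2.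
- move=> y _ m n mn; rewrite !W_sum.
  by apply: lee_sum_nneg_natr => // k _ _.
Qed.

(** The Markov property at time [1] for entire plays, obtained by monotone
    convergence from the finite horizon identity [partial_play]. *)
Lemma play_valueE (r : E -> R) x : measurable_fun setT r ->
  (forall y, (0 <= r y <= 1)%R) ->
  play_value r x = bellman Pi alpha q r a b c (play_value p) x.
Proof.
move=> mr r01.
have [[_ gr] [_ gr']] := payoff_prob mr r01.
have [[_ gq] [_ gq']] := payoff_prob mq q01.
have /andP[/ltW al0 _] := model_discount (model x).
have cv1 : \sum_(0 <= k < n.+1) collected (P x) X eta alpha q
    (inhomogeneous_time X xi (first_step r)) k a b c @[n --> \oo] -->
    play_value r x.
  rewrite (cvg_shiftS (fun n => \sum_(0 <= k < n) collected (P x) X eta alpha q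
    (inhomogeneous_time X xi (first_step r)) k a b c)).
  by apply: is_cvg_nneseries => n _ _.
rewrite -(cvg_lim _ cv1)//; apply: cvg_lim => //.
under eq_cvg do rewrite partial_play//.
have intW0 n : 0 <= \int[Pi x]_y W n y.
  by apply: integral_ge0 => y _; exact: (payoffW n).2.
have int0 : 0 <= \int[Pi x]_y play_value p y.
  by apply: integral_ge0 => y _; exact: payoff_play_value.2.
apply: cvgeD; [|exact: cvg_cst|].
  rewrite ge0_adde_def// inE ?mule_ge0//.
    exact: (payoff_stop_value mq q01 ga gc).2.
  exact: (payoff_cont_value (model x) mq q01 gb payoff_play_value).2.
apply: cvgeZl => //; apply: cvgeD; [|apply: cvgeZl => //|exact: cvg_cst].
  by rewrite ge0_adde_def// inE ?mule_ge0// ?lee_fin//; exact: gb.2.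
exact: cvgeZl.
Qed.

End play_values.

(** * The necessary conditions *)

Section necessary_conditions.
Hypotheses (valueV : forall y,
    reward (P y) alpha X f g h (markovian_time X xi p) sigma = (V y)%:E)
  (optV : forall y tau, stopping_times X xi tau ->
    reward (P y) alpha X f g h tau sigma <= (V y)%:E).

Let Jp := play_value (EFin \o f^\+%R) (EFin \o g^\+%R) (EFin \o h^\+%R).
Let Jm := play_value (EFin \o f^\-%R) (EFin \o g^\-%R) (EFin \o h^\-%R).

Let first_step_stopping r : measurable_fun setT r ->
  stopping_times X xi (inhomogeneous_time X xi (first_step r)).
Proof. by move=> mr; apply: inhomogeneous_stopping => -[|k]. Qed.

Let split_deviation r y : measurable_fun setT r ->
  [/\ 0 <= Jp r y < +oo, 0 <= Jm r y < +oo &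
    reward (P y) alpha X f g h (inhomogeneous_time X xi (first_step r)) sigma =
    Jp r y - Jm r y].
Proof.
move=> mr.
have [? ? ?] := reward_split (model y) mq (first_step_stopping mr) mf mg mh
  mZ Z0 (Zoo y) fZ gZ hZ.
by split.
Qed.

Let first_step_p : inhomogeneous_time X xi (first_step p) =
  markovian_time X xi p.
Proof.
rewrite -(inhomogeneous_timeE X xi p); congr inhomogeneous_time.
by apply/funext => -[|k].
Qed.

(** The two finite parts of the value are hidden behind a specification, so that
   unification never unfolds them into series. *)
Let real_parts :
  {n : (E -> R) * (E -> R) | Jp p = EFin \o n.1 & Jm p = EFin \o n.2}.
Proof.
exists (fun y => fine (Jp p y), fun y => fine (Jm p y)); apply/funext => y;
  have [Jpb Jmb _] := split_deviation y mp;
  by rewrite /= fineK// ge0_lty_fin_num.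
Qed.

Let np := (s2val real_parts).1.
Let nm := (s2val real_parts).2.
Let JpE : Jp p = EFin \o np := s2valP real_parts.
Let JmE : Jm p = EFin \o nm := s2valP' real_parts.

Let VE y : V y = (np y - nm y)%R.
Proof.
have [_ _ E1] := split_deviation y mp.
by move: E1; rewrite first_step_p valueV JpE JmE => -[].
Qed.

Let gpos (v : E -> R) : measurable_fun setT v -> payoff (EFin \o v^\+%R).
Proof. by move=> mv; apply: payoff_EFin => //; exact: measurable_funrpos. Qed.

Let gneg (v : E -> R) : measurable_fun setT v -> payoff (EFin \o v^\-%R).
Proof. by move=> mv; apply: payoff_EFin => //; exact: measurable_funrneg. Qed.

Let JpB (r : E -> R) y : measurable_fun setT r ->
  (forall y, (0 <= r y <= 1)%R) ->
  Jp r y = bellman Pi alpha q r (EFin \o f^\+%R) (EFin \o g^\+%R)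
    (EFin \o h^\+%R) (EFin \o np) y.
Proof.
move=> mr r01; rewrite /Jp (play_valueE (gpos mf) (gpos mg) (gpos mh))//.
by rewrite -/Jp JpE.
Qed.

Let JmB (r : E -> R) y : measurable_fun setT r ->
  (forall y, (0 <= r y <= 1)%R) ->
  Jm r y = bellman Pi alpha q r (EFin \o f^\-%R) (EFin \o g^\-%R)
    (EFin \o h^\-%R) (EFin \o nm) y.
Proof.
move=> mr r01; rewrite /Jm (play_valueE (gneg mf) (gneg mg) (gneg mh))//.
by rewrite -/Jm JmE.
Qed.

Let payoff_np : payoff (EFin \o np).
Proof.
by rewrite -JpE; exact: (payoff_play_value (gpos mf) (gpos mg) (gpos mh)).
Qed.

Let payoff_nm : payoff (EFin \o nm).
Proof.
by rewrite -JmE; exact: (payoff_play_value (gneg mf) (gneg mg) (gneg mh)).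
Qed.

Let kernel_fin y (a b c n : E -> R) :
  (q y < 1)%R -> payoff (EFin \o n) ->
  bellman Pi alpha q (cst 0%R) (EFin \o a) (EFin \o b) (EFin \o c)
    (EFin \o n) y < +oo ->
  \int[Pi y]_z (n z)%:E \is a fin_num.
Proof.
move=> q1 [mn n0]; have /andP[al0 _] := model_discount (model y).
have int0 : 0 <= \int[Pi y]_z (n z)%:E by apply: integral_ge0 => z _; exact: n0.
rewrite /bellman stop_valueE /cont_value ge0_fin_numE// -/(EFin \o n).
rewrite mul0e add0e subr0 mul1e.
case: (\int[Pi y]_z (n z)%:E) int0 => [r _ _| _ |//]; first exact: ltry.
rewrite mulry gtr0_sg// mul1e mulry gtr0_sg ?subr_gt0// mul1e.
by rewrite addye.
Qed.

(** If the opponent stops at [y] for sure, nothing after the first period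
    matters and the kernel term is multiplied by [0], whatever its value.
    Otherwise the deviation that always continues at [y] has a finite reward,
    which forces both parts of [V] to be integrable under [Pi y]. *)
Lemma deviation_value y : exists2 c : R,
  continuation Pi alpha q V g y = c%:E &
  forall r : E -> R, measurable_fun setT r ->
    (forall y, (0 <= r y <= 1)%R) ->
    reward (P y) alpha X f g h (inhomogeneous_time X xi (first_step r)) sigma =
    (r y * ((1 - q y) * f y + q y * h y) + (1 - r y) * c)%:E.
Proof.
suff [cp [cm [cpE cmE cE]]] : exists cp cm, [/\
    cont_value Pi alpha q (EFin \o g^\+%R) (EFin \o np) y = cp%:E,
    cont_value Pi alpha q (EFin \o g^\-%R) (EFin \o nm) y = cm%:E &
    continuation Pi alpha q V g y = (cp - cm)%:E].
  exists (cp - cm)%R => // r mr r01; have [_ _ ->] := split_deviation y mr.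
  rewrite JpB// JmB// /bellman cpE cmE !stop_valueE.
  rewrite -!EFinM -!EFinD; congr EFin.
  by rewrite -(posnegE f y) -(posnegE h y); ring.
have [q1|q1] := eqVneq (q y) 1%R.
  exists (g^\+ y)%R, (g^\- y)%R; rewrite /cont_value /continuation q1 subrr.
  by rewrite !mul0e !add0e !mul1e mul1r (posnegE g y).
have {}q1 : (q y < 1)%R by rewrite lt_neqAle q1; case/andP: (q01 y).
have m0 : measurable_fun setT (cst 0%R : E -> R) by [].
have c01 (z : E) : (0 <= (cst 0%R : E -> R) z <= 1)%R by rewrite /= lexx ler01.
have [/andP[_ Jpoo] /andP[_ Jmoo] _] := split_deviation y m0.
rewrite (JpB _ m0 c01) in Jpoo; rewrite (JmB _ m0 c01) in Jmoo.
have pfin := kernel_fin q1 payoff_np Jpoo.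
have mfin := kernel_fin q1 payoff_nm Jmoo.
rewrite !cont_valueE//; eexists; eexists; split; [by []|by []|].
have kE : kernel_op Pi V y =
    (fine (\int[Pi y]_z (np z)%:E) - fine (\int[Pi y]_z (nm z)%:E))%:E.
  rewrite EFinB (fineK pfin) (fineK mfin) /kernel_op.
  have int (n : E -> R) : payoff (EFin \o n) ->
      \int[Pi y]_z (n z)%:E \is a fin_num ->
      (Pi y).-integrable setT (EFin \o n).
    move=> [mn n0] nfin; apply/integrableP; split => //.
    under eq_integral => z _ do rewrite gee0_abs//.
    by rewrite -ge0_fin_numE//; apply: integral_ge0 => z _; exact: n0.
  rewrite -integralB_EFin//; [|exact: int|exact: int].
  by apply: eq_integral => z _; rewrite VE EFinB.
rewrite /continuation kE -!EFinM -EFinD; congr EFin.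
by rewrite -(posnegE g y); ring.
Qed.

(** The deviations [0], [1] and [p] itself give [C <= V], [S <= V] and
    [V = p S + (1 - p) C], where [S] and [C] are the values of stopping and of
    continuing; hence [V] is the maximum, and [p] gives weight to maximal values
    only. *)
Lemma necessary_conditions y :
  [/\ (V y)%:E = maxe (continuation Pi alpha q V g y) (stopping q f h y),
    ((0 < p y)%R -> continuation Pi alpha q V g y <= stopping q f h y) &
    ((p y < 1)%R -> stopping q f h y <= continuation Pi alpha q V g y)].
Proof.
have [c -> dev] := deviation_value y; rewrite /stopping.
set s := ((1 - q y) * f y + q y * h y)%R.
have cst01 (k : R) : (0 <= k <= 1)%R ->
    measurable_fun setT (cst k : E -> R) /\
    forall z : E, (0 <= (cst k : E -> R) z <= 1)%R by [].
have [m0 c0] : measurable_fun setT (cst 0%R : E -> R) /\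
    forall z : E, (0 <= (cst 0%R : E -> R) z <= 1)%R.
  by apply: cst01; rewrite lexx ler01.
have [m1 c1] : measurable_fun setT (cst 1%R : E -> R) /\
    forall z : E, (0 <= (cst 1%R : E -> R) z <= 1)%R.
  by apply: cst01; rewrite lexx ler01.
have cV : (c <= V y)%R.
  have := optV y (first_step_stopping m0); rewrite dev// lee_fin /=.
  by rewrite mul0r add0r subr0 mul1r.
have sV : (s <= V y)%R.
  have := optV y (first_step_stopping m1); rewrite dev// lee_fin /=.
  by rewrite mul1r subrr mul0r addr0.
have VpE : V y = (p y * s + (1 - p y) * c)%R.
  by have := dev p mp p01; rewrite first_step_p valueV => -[].
have /andP[p0 p1] := p01 y.
have cs : (0 < p y)%R -> (c <= s)%R.
  by move=> py; rewrite -(ler_pM2l py); move: cV; rewrite VpE; lra.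
have sc : (p y < 1)%R -> (s <= c)%R.
  move=> py; have py' : (0 < 1 - p y)%R by rewrite subr_gt0.
  by rewrite -(ler_pM2l py'); move: sV; rewrite VpE; lra.
split; rewrite ?lee_fin//; rewrite -EFin_max; congr EFin.
have [p00|pn0] := eqVneq (p y) 0%R.
  have py : (p y < 1)%R by rewrite p00 ltr01.
  by rewrite (max_idPl (sc py)) VpE p00 mul0r add0r subr0 mul1r.
have py : (0 < p y)%R by rewrite lt_neqAle eq_sym pn0.
rewrite (max_idPr (cs py)); apply/eqP; rewrite eq_le sV andbT VpE.
by have := cs py; have := p1; nra.
Qed.

End necessary_conditions.

End one_shot_deviation.

End player_family.

(** * From one player to the equilibrium *)

Section suprema.
Context d d' (E : measurableType d) (Omega : measurableType d') (R : realType).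
Variables (X : nat -> {mfun Omega >-> E}) (T : {mfun Omega >-> nat}).
Implicit Types (v : E -> R).

(** The killed process ends in the cemetery, where all functions vanish. *)
Lemma sup_killed_ge0 v w : 0 <= sup_killed T X v w.
Proof.
apply: ereal_sup_ubound; exists (T w).+1 => //.
by rewrite /killed ltnn.
Qed.

Lemma sup_killed_ge v n w : (n <= T w)%N ->
  (v (X n w))%:E <= sup_killed T X v w.
Proof.
by move=> nT; apply: ereal_sup_ubound; exists n => //; rewrite /killed nT.
Qed.

Lemma dominated_sup_abs v :
  dominated X T (fun y => `|v y|)%R (sup_abs_killed T X v).
Proof. by move=> n w; exact: sup_killed_ge. Qed.

Lemma measurable_sup_killed v : measurable_fun setT v ->
  measurable_fun setT (sup_killed T X v).
Proof.
move=> mv.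
have -> : sup_killed T X v =
    fun w => esups (fun n => (ext0 v (killed T X n w))%:E) 0%N.
  apply/funext => w; rewrite /sup_killed /esups /sdrop; congr ereal_sup.
  by apply/seteqP; split => y [n _ <-]; exists n.
apply: measurable_fun_esups => n; apply/measurable_EFinP.
have mT : measurable_fun setT (fun w => (n <= T w)%N).
  exact: (measurableT_comp (f := fun k => (n <= k)%N)).
rewrite (_ : (fun w => _) = fun w => if (n <= T w)%N then v (X n w) else 0%R).
  apply: measurable_fun_ifT => //.
  by apply: (measurableT_comp (f := v)).
by apply/funext => w; rewrite /killed; case: ifP.
Qed.

Lemma dominatedS v (Z Z' : Omega -> \bar R) : (forall w, Z w <= Z' w) ->
  dominated X T v Z -> dominated X T v Z'.
Proof. by move=> ZZ' vZ n w nT; apply: le_trans (ZZ' w); exact: vZ. Qed.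

End suprema.

Section player_theorem.
Context d d' (E : measurableType d) (Omega : measurableType d') (R : realType).
Variables (P : E -> probability Omega R) (X : nat -> {mfun Omega >-> E})
  (xi eta : nat -> {mfun Omega >-> R}) (T : {mfun Omega >-> nat})
  (Pi : R.-pker E ~> E) (alpha : R).
Hypotheses (model : forall x, randomized_model (P x) X xi eta T Pi alpha)
  (start : forall x B, measurable B -> distribution (P x) (X 0%N) B = \d_x B).
Variables (f g h p q V : E -> R).
Hypotheses (mf : measurable_fun setT f) (mg : measurable_fun setT g)
  (mh : measurable_fun setT h) (mp : measurable_fun setT p)
  (mq : measurable_fun setT q) (mV : measurable_fun setT V)
  (p01 : forall y, (0 <= p y <= 1)%R) (q01 : forall y, (0 <= q y <= 1)%R)
  (f_L1 : forall x, L1 (P x) (sup_abs_killed T X f))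
  (g_L1 : forall x, L1 (P x) (sup_abs_killed T X g))
  (h_L1 : forall x, L1 (P x) (sup_abs_killed T X h)).

Local Notation tau := (markovian_time X xi p).
Local Notation sigma := (markovian_time X eta q).

Let Z w := sup_abs_killed T X f w + sup_abs_killed T X g w +
  sup_abs_killed T X h w.

Let mabs (v : E -> R) : measurable_fun setT v ->
  measurable_fun setT (sup_abs_killed T X v).
Proof.
by move=> mv; apply: measurable_sup_killed; exact: measurableT_comp.
Qed.

Let abs0 (v : E -> R) w : 0 <= sup_abs_killed T X v w.
Proof. exact: sup_killed_ge0. Qed.

Let mZ : measurable_fun setT Z.
Proof. by apply: emeasurable_funD; [apply: emeasurable_funD|]; exact: mabs. Qed.

Let Z0 w : 0 <= Z w.
Proof. by rewrite /Z !adde_ge0. Qed.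

Let L1_lty x (W : Omega -> \bar R) : (forall w, 0 <= W w) -> L1 (P x) W ->
  \int[P x]_w W w < +oo.
Proof.
move=> W0 /integrableP[_]; congr (_ < _).
by apply: eq_integral => w _; rewrite gee0_abs.
Qed.

Let Zoo x : \int[P x]_w Z w < +oo.
Proof.
have Lf := L1_lty (abs0 f) (f_L1 x).
have Lg := L1_lty (abs0 g) (g_L1 x).
have Lh := L1_lty (abs0 h) (h_L1 x).
rewrite ge0_integralD//; [|by move=> w _; rewrite adde_ge0| |exact: mabs].
  rewrite ge0_integralD//; [|exact: mabs|exact: mabs].
  by apply: lte_add_pinfty => //; exact: lte_add_pinfty.
by apply: emeasurable_funD; exact: mabs.
Qed.

Let fle w : sup_abs_killed T X f w <= Z w.
Proof. by rewrite /Z -addeA leeDl// adde_ge0. Qed.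

Let gle w : sup_abs_killed T X g w <= Z w.
Proof. by rewrite /Z addeAC leeDr// adde_ge0. Qed.

Let hle w : sup_abs_killed T X h w <= Z w.
Proof. by rewrite /Z leeDr// adde_ge0. Qed.

(** The suprema of [f], [g], [h] along the killed process add up to one
    integrable bound. *)
Lemma player_necessary :
  (forall x, reward (P x) alpha X f g h tau sigma =
    ereal_sup [set reward (P x) alpha X f g h t sigma
              | t in stopping_times X xi]) ->
  (forall x, (V x)%:E = reward (P x) alpha X f g h tau sigma) ->
  forall y,
  [/\ (V y)%:E = maxe (continuation Pi alpha q V g y) (stopping q f h y),
    ((0 < p y)%R -> continuation Pi alpha q V g y <= stopping q f h y) &
    ((p y < 1)%R -> stopping q f h y <= continuation Pi alpha q V g y)].
Proof.
move=> opt val.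
apply: (necessary_conditions model start mf mg mh mp mq p01 q01 mZ Z0 Zoo
  (dominatedS fle (@dominated_sup_abs _ _ _ _ _ X T f))
  (dominatedS gle (@dominated_sup_abs _ _ _ _ _ X T g))
  (dominatedS hle (@dominated_sup_abs _ _ _ _ _ X T h))).
  by move=> x; rewrite val.
by move=> x t st; rewrite val opt; apply: ereal_sup_ubound; exists t.
Qed.

(** The bound now has to cover [V] too. From above, [V] is controlled by its own
    supremum; from below, by [V >= (1 - q) f + q h >= - |f| - |h|]. *)
Lemma player_sufficient :
  (forall y,
    [/\ (V y)%:E = maxe (continuation Pi alpha q V g y) (stopping q f h y),
      ((0 < p y)%R -> continuation Pi alpha q V g y <= stopping q f h y) &
      ((p y < 1)%R -> stopping q f h y <= continuation Pi alpha q V g y)]) ->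
  (forall x, \int[P x]_w sup_killed T X V w < +oo) ->
  forall x, reward (P x) alpha X f g h tau sigma =
    ereal_sup [set reward (P x) alpha X f g h t sigma
              | t in stopping_times X xi] /\
    (V x)%:E = reward (P x) alpha X f g h tau sigma.
Proof.
move=> system Voo x.
have CV y : continuation Pi alpha q V g y <= (V y)%:E.
  by have [-> _ _] := system y; rewrite le_max lexx.
have SV y : stopping q f h y <= (V y)%:E.
  by have [-> _ _] := system y; rewrite le_max lexx orbT.
pose ZV w := Z w + sup_killed T X V w.
have sup0 w : 0 <= sup_killed T X V w by exact: sup_killed_ge0.
have ZZV w : Z w <= ZV w by rewrite /ZV leeDl.
have ZV0 w : 0 <= ZV w by rewrite adde_ge0.
have mZV : measurable_fun setT ZV.
  by apply: emeasurable_funD => //; exact: measurable_sup_killed.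
have ZVoo y : \int[P y]_w ZV w < +oo.
  rewrite ge0_integralD//; last exact: measurable_sup_killed.
  by apply: lte_add_pinfty; [exact: Zoo|exact: Voo].
have fZ : dominated X T (fun y => `|f y|)%R ZV.
  apply: dominatedS (@dominated_sup_abs _ _ _ _ _ X T f) => w.
  exact: le_trans (fle w) (ZZV w).
have gZ : dominated X T (fun y => `|g y|)%R ZV.
  apply: dominatedS (@dominated_sup_abs _ _ _ _ _ X T g) => w.
  exact: le_trans (gle w) (ZZV w).
have hZ : dominated X T (fun y => `|h y|)%R ZV.
  apply: dominatedS (@dominated_sup_abs _ _ _ _ _ X T h) => w.
  exact: le_trans (hle w) (ZZV w).
have VZ : dominated X T (fun y => `|V y|)%R ZV.
  move=> n w nT; have [V0|V0] := leP 0%R (V (X n w)).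
    rewrite ger0_norm//; apply: (@le_trans _ _ (sup_killed T X V w)).
      exact: sup_killed_ge.
    by rewrite /ZV leeDr.
  apply: (le_trans _ (ZZV w)).
  apply: (@le_trans _ _ (`|f (X n w)|%R%:E + `|h (X n w)|%R%:E)).
    rewrite -EFinD lee_fin ltr0_norm//.
    have := SV (X n w); rewrite /stopping lee_fin.
    have /andP[q0 q1] := q01 (X n w).
    have := ler_norm (- f (X n w)); have := ler_norm (- h (X n w)).
    rewrite !normrN; have := normr_ge0 (f (X n w)).
    have := normr_ge0 (h (X n w)); nra.
  rewrite /Z addeAC; apply: (@le_trans _ _
      (sup_abs_killed T X f w + sup_abs_killed T X h w)).
    by apply: leeD; exact: dominated_sup_abs.
  by rewrite leeDl.
have eqV y : reward (P y) alpha X f g h tau sigma = (V y)%:E.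
  exact: (verification_eq model start mf mg mh mp mq p01 q01 mZV ZV0 ZVoo
    fZ gZ hZ mV VZ).
split; last by rewrite eqV.
rewrite eqV; apply/eqP; rewrite eq_le; apply/andP; split.
  rewrite -eqV; apply: ereal_sup_ubound; exists tau => //.
  by rewrite -(inhomogeneous_timeE X xi p); exact: inhomogeneous_stopping.
apply: ge_ereal_sup => _ [t st <-].
exact: (verification_le model start mf mg mh mq q01 mZV ZV0 ZVoo
  fZ gZ hZ mV VZ).
Qed.

End player_theorem.

Theorem theorem4p2 (R : realType) (d d' : measure_display)
  (E : measurableType d) (Omega : measurableType d')
  (Pi : R.-pker E ~> E) (P : E -> probability Omega R)
  (X : nat -> {mfun Omega >-> E}) (xi1 xi2 : nat -> {mfun Omega >-> R})
  (T : {mfun Omega >-> nat}) (alpha : R)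
  (f1 g1 h1 f2 g2 h2 : E -> R)
  (alpha01 : (0 < alpha < 1)%R)
  (X_markov : markov_process Pi P X)
  (xi1_iid : forall x, iid_uniform (P x) xi1)
  (xi2_iid : forall x, iid_uniform (P x) xi2)
  (T_law : forall x, killing_time (P x) alpha T)
  (indep : forall x, independent4 (P x)
    (sigma_process X setT) (sigma_process xi1 setT) (sigma_process xi2 setT)
    (preimage_set_system setT T measurable))
  (mf1 : measurable_fun setT f1) (mg1 : measurable_fun setT g1)
  (mh1 : measurable_fun setT h1) (mf2 : measurable_fun setT f2)
  (mg2 : measurable_fun setT g2) (mh2 : measurable_fun setT h2)
  (f1_L1 : forall x, L1 (P x) (sup_abs_killed T X f1))
  (g1_L1 : forall x, L1 (P x) (sup_abs_killed T X g1))
  (h1_L1 : forall x, L1 (P x) (sup_abs_killed T X h1))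
  (f2_L1 : forall x, L1 (P x) (sup_abs_killed T X f2))
  (g2_L1 : forall x, L1 (P x) (sup_abs_killed T X g2))
  (h2_L1 : forall x, L1 (P x) (sup_abs_killed T X h2))
  (p1 p2 V1 V2 : E -> R)
  (mp1 : measurable_fun setT p1) (mp2 : measurable_fun setT p2)
  (p1_01 : forall x, (0 <= p1 x <= 1)%R) (p2_01 : forall x, (0 <= p2 x <= 1)%R)
  (mV1 : measurable_fun setT V1) (mV2 : measurable_fun setT V2) :
  (global_equilibrium P alpha X xi1 xi2 f1 g1 h1 f2 g2 h2 p1 p2 ->
   equilibrium_values P alpha X xi1 xi2 f1 g1 h1 f2 g2 h2 p1 p2 V1 V2 ->
   equilibrium_system Pi alpha f1 g1 h1 f2 g2 h2 p1 p2 V1 V2)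
  /\
  (equilibrium_system Pi alpha f1 g1 h1 f2 g2 h2 p1 p2 V1 V2 ->
   (forall x, L1 (P x) (fun w => (ext0 V1 (killed T X 1%N w))%:E)) ->
   (forall x, L1 (P x) (fun w => (ext0 V2 (killed T X 1%N w))%:E)) ->
   (forall x, \int[P x]_w sup_killed T X V1 w < +oo) ->
   (forall x, \int[P x]_w sup_killed T X V2 w < +oo) ->
   global_equilibrium P alpha X xi1 xi2 f1 g1 h1 f2 g2 h2 p1 p2 /\
   equilibrium_values P alpha X xi1 xi2 f1 g1 h1 f2 g2 h2 p1 p2 V1 V2).
Proof.
have start x B : measurable B -> distribution (P x) (X 0%N) B = \d_x B.
  exact: (X_markov x).1.
have model x : randomized_model (P x) X xi1 xi2 T Pi alpha.
  by split => //; exact: (X_markov x).2.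
have model' x : randomized_model (P x) X xi2 xi1 T Pi alpha.
  exact: randomized_model_swap.
split=> [eqm val y|system _ _ V1oo V2oo].
  have [V1E c1 d1] := player_necessary model start mf1 mg1 mh1 mp1 mp2
    p1_01 p2_01 f1_L1 g1_L1 h1_L1 (fun x => (eqm x).1) (fun x => (val x).1) y.
  have [V2E c2 d2] := player_necessary model' start mf2 mg2 mh2 mp2 mp1
    p2_01 p1_01 f2_L1 g2_L1 h2_L1 (fun x => (eqm x).2) (fun x => (val x).2) y.
  by do ![split=> //].
have S1 := player_sufficient model start mf1 mg1 mh1 mp1 mp2 mV1
  p1_01 p2_01 f1_L1 g1_L1 h1_L1 (fun y =>
    let: conj a (conj _ (conj c (conj d _))) := system y in And3 a c d) V1oo.
have S2 := player_sufficient model' start mf2 mg2 mh2 mp2 mp1 mV2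
  p2_01 p1_01 f2_L1 g2_L1 h2_L1 (fun y =>
    let: conj _ (conj b (conj _ (conj _ (conj e f)))) := system y in
    And3 b e f) V2oo.
rewrite /global_equilibrium /equilibrium_values /=.
by split=> x; have [? ?] := S1 x; have [? ?] := S2 x; split.
Qed.
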